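(* Consider Algorithm (A) or Algorithm (B) with their surrogates $d_k$ (see context) and assume $\eta_k\le1/L$ for all $k\ge1$. Then, for all $k\ge1$, $$\mathbb E[\delta_k(F(x_k)-F^\star)+d_k(x^\star)-d_k^\star]\le\Gamma_k\left(d_0(x^\star)-d_0^\star+\sum_{t=1}^k\frac{\delta_t\eta_t\omega_t^2}{\Gamma_t}\right),$$ where $\Gamma_k=\prod_{t=1}^k(1-\delta_t)$ and $\omega_t^2=\mathbb E[\|g_t-\nabla f(x_{t-1})\|^2]$. Moreover, for any point $\hat x_0$ (possibly equal to $x_0$), with the averaging strategy $\hat x_k=(1-\delta_k)\hat x_{k-1}+\delta_kx_k$ for $k\ge1$, we have for all $k\ge1$ $$\mathbb E[F(\hat x_k)-F^\star+d_k(x^\star)-d_k^\star]\le\Gamma_k\left(F(\hat x_0)-F^\star+d_0(x^\star)-d_0^\star+\sum_{t=1}^k\frac{\delta_t\eta_t\omega_t^2}{\Gamma_t}\right).$$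
   Context: Problem: minimize $F=f+\psi$ on $\mathbb R^p$; $f$ is convex, $L$-smooth (differentiable with $L$-Lipschitz gradient) and $\mu$-strongly convex with $\mu\ge0$ ($\mu=0$ meaning merely convex); $\psi:\mathbb R^p\to\mathbb R\cup\{+\infty\}$ is proper convex lower semicontinuous; $x^\star$ is a minimizer of $F$, $F^\star=F(x^\star)$. $\mathrm{Prox}_{\eta\psi}[u]=\arg\min_x\{\eta\psi(x)+\frac12\|x-u\|^2\}$. Algorithms: step sizes $\eta_k>0$ are deterministic; $g_k$ satisfies $\mathbb E[g_k\mid\mathcal F_{k-1}]=\nabla f(x_{k-1})$, where $\mathcal F_{k-1}$ is the filtration representing all information up to iteration $k-1$. Parameters: $\gamma_0\ge\mu$, $\gamma_0>0$, and for $k\ge1$, $\delta_k=\eta_k\gamma_k$, $\gamma_k=(1-\delta_k)\gamma_{k-1}+\mu\delta_k$. (A): $x_k=\mathrm{Prox}_{\eta_k\psi}[x_{k-1}-\eta_kg_k]$, starting from $x_0$. (B): $x_0=\mathrm{Prox}_{\psi/\gamma_0}[\bar x_0]$, $\bar x_k=(1-\mu\eta_k)\bar x_{k-1}+\mu\eta_kx_{k-1}-\eta_kg_k$, $x_k=\mathrm{Prox}_{\psi/\gamma_k}[\bar x_k]$. Surrogates: $d_k^\star=\min d_k$. For (A): $d_0(x)=d_0^\star+\frac{\gamma_0}2\|x-x_0\|^2$ ($d_0^\star$ an arbitrary real), $d_k(x)=(1-\delta_k)d_{k-1}(x)+\delta_k\big(f(x_{k-1})+g_k^\top(x-x_{k-1})+\frac\mu2\|x-x_{k-1}\|^2+\psi(x_k)+\psi'(x_k)^\top(x-x_k)\big)$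 with $\psi'(x_k)=\frac1{\eta_k}(x_{k-1}-x_k)-g_k\in\partial\psi(x_k)$; then $d_k(x)=d_k^\star+\frac{\gamma_k}2\|x-x_k\|^2$. For (B): $d_0(x)=c_0+\frac{\gamma_0}2\|x-\bar x_0\|^2+\psi(x)$ ($c_0$ an arbitrary real), $d_k(x)=(1-\delta_k)d_{k-1}(x)+\delta_k\big(f(x_{k-1})+g_k^\top(x-x_{k-1})+\frac\mu2\|x-x_{k-1}\|^2+\psi(x)\big)$, minimized at $x_k$. Convention: $\Gamma_k/\Gamma_t=\prod_{i=t+1}^k(1-\delta_i)$ (relevant only if some $\delta_i=1$). *)

(* Defs.v *)
(* Points of R^p are row vectors, of type 'rV[R]_p. *)
From HB Require Import structures.
From mathcomp Require Import all_boot all_order all_algebra.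
From mathcomp Require Import all_classical all_reals all_analysis.

Set Implicit Arguments.
Unset Strict Implicit.
Unset Printing Implicit Defensive.

Import Order.TTheory GRing.Theory Num.Theory.
Import numFieldNormedType.Exports.

Local Open Scope classical_set_scope.
Local Open Scope ring_scope.

(* The norm `|u| of the library on row vectors is the sup norm; the Euclidean
   structure is therefore defined here.  Both norms give the same topology, so
   [differentiable] and [lower_semicontinuous] below have their usual meaning. *)
Definition dot (R : realType) (p : nat) (u v : 'rV[R]_p) : R :=
  \sum_(i < p) u 0 i * v 0 i.

Definition sqnorm (R : realType) (p : nat) (u : 'rV[R]_p) : R := dot u u.

Definition enorm (R : realType) (p : nat) (u : 'rV[R]_p) : R :=
  Num.sqrt (sqnorm u).

Definition gradient (R : realType) (p : nat) (f : 'rV[R]_p -> R)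
    (x : 'rV[R]_p) : 'rV[R]_p :=
  \row_(i < p) 'D_(delta_mx 0 i) f x.

Definition smooth (R : realType) (p : nat) (L : R) (f : 'rV[R]_p -> R) : Prop :=
  (forall x, differentiable f x) /\
  (forall x y, enorm (gradient f x - gradient f y) <= L * enorm (x - y)).

(* For mu = 0 this is plain convexity. *)
Definition strongly_convex (R : realType) (p : nat) (mu : R)
    (f : 'rV[R]_p -> R) : Prop :=
  forall (x y : 'rV[R]_p) (t : R), 0 <= t -> t <= 1 ->
    f (t *: x + (1 - t) *: y) <=
      t * f x + (1 - t) * f y - mu / 2 * t * (1 - t) * sqnorm (x - y).

Definition proper_efun (R : realType) (p : nat) (psi : 'rV[R]_p -> \bar R) : Prop :=
  (forall x, psi x != -oo%E) /\ (exists x, psi x != +oo%E).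

Definition econvex (R : realType) (p : nat) (psi : 'rV[R]_p -> \bar R) : Prop :=
  forall (x y : 'rV[R]_p) (t : R), 0 <= t -> t <= 1 ->
    (psi (t *: x + (1 - t) *: y)%R <= t%:E * psi x + (1 - t)%:E * psi y)%E.

Definition composite (R : realType) (p : nat) (f : 'rV[R]_p -> R)
    (psi : 'rV[R]_p -> \bar R) (x : 'rV[R]_p) : \bar R :=
  ((f x)%:E + psi x)%E.

Definition argmin (R : realType) (p : nat) (h : 'rV[R]_p -> \bar R) :
    set 'rV[R]_p :=
  [set x | forall y, (h x <= h y)%E].

(* The minimal value of h, when the infimum is attained (as it is for the
   surrogates d_k). *)
Definition minval (R : realType) (p : nat) (h : 'rV[R]_p -> \bar R) : \bar R :=
  ereal_inf (range h).

(* Prox_{eta psi}[u].  For eta > 0 and psi proper, convex and lower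
   semicontinuous the set of minimizers is a singleton, and the default value
   of [xget] is not used. *)
Definition prox (R : realType) (p : nat) (eta : R) (psi : 'rV[R]_p -> \bar R)
    (u : 'rV[R]_p) : 'rV[R]_p :=
  xget 0 (argmin (fun y => (eta%:E * psi y + (2^-1 * sqnorm (y - u))%:E)%E)).

(* gamma_k and delta_k are defined implicitly by a system that is linear in
   gamma_k and, since gamma_(k-1) >= mu, has exactly one solution.  The values
   eta 0 and delta 0 are irrelevant. *)
Definition parameters (R : realType) (mu : R) (eta gamma delta : nat -> R) :
    Prop :=
  [/\ mu <= gamma 0%N, 0 < gamma 0%N,
      (forall k, 0 < eta k.+1),
      (forall k, delta k.+1 = eta k.+1 * gamma k.+1) &
      (forall k, gamma k.+1 =
         (1 - delta k.+1) * gamma k + mu * delta k.+1)].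

(* Gamma_k / Gamma_t, also when Gamma_t = 0; Gamma_k is [decay delta 0 k]. *)
Definition decay (R : realType) (delta : nat -> R) (t k : nat) : R :=
  \prod_(t.+1 <= i < k.+1) (1 - delta i).

Definition filtration d (T : measurableType d) (Fil : nat -> set (set T)) :
    Prop :=
  [/\ (forall k, sigma_algebra setT (Fil k)),
      (forall k, Fil k `<=` measurable) &
      (forall k, Fil k `<=` Fil k.+1)].

Definition borel_wrt (T : Type) (G : set (set T)) (U : topologicalType)
    (X : T -> U) : Prop :=
  forall B, <<s @open U >> B -> G (X @^-1` B).

(* Y is a version of E[X | G]. *)
Definition is_cond_exp d (T : measurableType d) (R : realType)
    (P : probability T R) (G : set (set T)) (X Y : T -> R) : Prop :=
  [/\ P.-integrable setT (EFin \o X),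
      P.-integrable setT (EFin \o Y),
      borel_wrt G Y &
      forall A, G A -> (\int[P]_(w in A) (X w)%:E = \int[P]_(w in A) (Y w)%:E)%E].

(* g k is the estimate used at iteration k >= 1; g 0 is irrelevant. *)
Definition unbiased_oracle d (T : measurableType d) (R : realType)
    (P : probability T R) (p : nat) (Fil : nat -> set (set T))
    (f : 'rV[R]_p -> R) (g x : nat -> T -> 'rV[R]_p) : Prop :=
  forall k,
    borel_wrt (Fil k.+1) (g k.+1) /\
    forall i : 'I_p, is_cond_exp P (Fil k)
      (fun w => g k.+1 w 0 i) (fun w => gradient f (x k w) 0 i).

(* omega_t^2, possibly +oo. *)
Definition noise_var d (T : measurableType d) (R : realType)
    (P : probability T R) (p : nat) (f : 'rV[R]_p -> R)
    (g x : nat -> T -> 'rV[R]_p) (t : nat) : \bar R :=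
  (\int[P]_w (sqnorm (g t w - gradient f (x t.-1 w)))%:E)%E.

(* f(z) + <v, y - z> + mu/2 |y - z|^2 *)
Definition quad_model (R : realType) (p : nat) (mu : R) (f : 'rV[R]_p -> R)
    (z v y : 'rV[R]_p) : R :=
  f z + dot v (y - z) + mu / 2 * sqnorm (y - z).

(* D k w is the random surrogate d_k, and D0 the deterministic function d_0.
   The initial point of the iteration and the constant in d_0 are arbitrary and
   deterministic. *)
Definition run_A (R : realType) (p : nat) (T : Type) (mu : R)
    (f : 'rV[R]_p -> R) (psi : 'rV[R]_p -> \bar R)
    (eta gamma delta : nat -> R) (g x : nat -> T -> 'rV[R]_p)
    (D0 : 'rV[R]_p -> \bar R) (D : nat -> T -> 'rV[R]_p -> \bar R) : Prop :=
  exists (x0 : 'rV[R]_p) (c0 : R),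
  [/\ (forall w, x 0%N w = x0),
      (forall k w, x k.+1 w =
         prox (eta k.+1) psi (x k w - eta k.+1 *: g k.+1 w)),
      (forall y, D0 y = (c0 + gamma 0%N / 2 * sqnorm (y - x0))%:E),
      (forall w, D 0%N w = D0) &
      (forall k w y, D k.+1 w y =
         let dpsi := (eta k.+1)^-1 *: (x k w - x k.+1 w) - g k.+1 w in
         ((1 - delta k.+1)%:E * D k w y +
          (delta k.+1)%:E *
            ((quad_model mu f (x k w) (g k.+1 w) y)%:E +
             psi (x k.+1 w) + (dot dpsi (y - x k.+1 w))%:E))%E)].

Definition run_B (R : realType) (p : nat) (T : Type) (mu : R)
    (f : 'rV[R]_p -> R) (psi : 'rV[R]_p -> \bar R)
    (eta gamma delta : nat -> R) (g x : nat -> T -> 'rV[R]_p)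
    (D0 : 'rV[R]_p -> \bar R) (D : nat -> T -> 'rV[R]_p -> \bar R) : Prop :=
  exists (xbar0 : 'rV[R]_p) (c0 : R) (xbar : nat -> T -> 'rV[R]_p),
  [/\ (forall w, xbar 0%N w = xbar0) /\
      (forall k w, xbar k.+1 w =
         (1 - mu * eta k.+1) *: xbar k w + (mu * eta k.+1) *: x k w
         - eta k.+1 *: g k.+1 w),
      (forall k w, x k w = prox (gamma k)^-1 psi (xbar k w)),
      (forall y, D0 y =
         ((c0 + gamma 0%N / 2 * sqnorm (y - xbar0))%:E + psi y)%E),
      (forall w, D 0%N w = D0) &
      (forall k w y, D k.+1 w y =
         ((1 - delta k.+1)%:E * D k w y +
          (delta k.+1)%:E *
            ((quad_model mu f (x k w) (g k.+1 w) y)%:E + psi y))%E)].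

Definition averaging (R : realType) (p : nat) (T : Type) (delta : nat -> R)
    (x : nat -> T -> 'rV[R]_p) (xhat0 : 'rV[R]_p)
    (xhat : nat -> T -> 'rV[R]_p) : Prop :=
  (forall w, xhat 0%N w = xhat0) /\
  (forall k w, xhat k.+1 w =
     (1 - delta k.+1) *: xhat k w + delta k.+1 *: x k.+1 w).

(* Main.v *)
(* Let n_t be the noise g_t - grad f(x_(t-1)) and let w_t be the point that the t-th
   step would produce without noise.  Smoothness, strong convexity and the
   minimality of x_t for the surrogate give, pointwise, with a_t = d_t(xstar) - min d_t,
     delta_t (F(x_t) - F(xstar)) + a_t
       <= (1 - delta_t) a_(t-1) + delta_t <n_t, xstar - x_t>,
   and nonexpansiveness of the proximal map bounds the last inner product by
   <n_t, xstar - w_t> + eta_t |n_t|^2.  Since w_t is known before g_t is drawn, the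
   first term has mean zero.  The inequality is unrolled pointwise and integrated
   once, so that the measurability of the surrogates is never used.  The mean-zero
   claim needs finite second moments, which propagate along the iteration from the
   last step with delta_t = 1, if any: there mu eta_t = 1, hence mu = L, and
   x - eta_t grad f(x) does not depend on x. *)
Require Import Defs.
From HB Require Import structures.
From mathcomp Require Import all_boot all_order all_algebra.
From mathcomp Require Import all_classical all_reals all_analysis.
From mathcomp Require Import measurable_realfun.
From mathcomp Require Import ring lra.

Set Implicit Arguments.
Unset Strict Implicit.
Unset Printing Implicit Defensive.

Import Order.TTheory GRing.Theory Num.Theory.
Import numFieldNormedType.Exports.

Local Open Scope classical_set_scope.
Local Open Scope ring_scope.

(** In both algorithms x_t is the image under a nonexpansive map of a state that contains g_t only
    as - eta_t g_t. Removing the noise thus moves x_t by at most eta_t |n_t|, the origin of the term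
    eta_t |n_t|^2, and one probabilistic argument over the common form [descent_run] serves both. Of
    a surrogate it retains two numbers, the value at xstar and the minimum. Proximal points exist
    because the optimality of xstar gives psi an affine minorant with slope - grad f(xstar), which
    the quadratic term dominates. The finite moments are extracted from the bound itself: if its
    right side is +oo there is nothing to prove, and if it is finite then every noise with a nonzero
    coefficient has finite variance. A coefficient vanishes only when a later step has delta = 1. *)

Section Euclidean.
Context {R : realType} {p : nat}.
Implicit Types (u v w : 'rV[R]_p) (c : R).

Lemma dotC u v : dot u v = dot v u.
Proof. by apply: eq_bigr => i _; rewrite mulrC. Qed.

Lemma dotDl u v w : dot (u + v) w = dot u w + dot v w.
Proof. by rewrite -big_split; apply: eq_bigr => i _; rewrite mxE mulrDl. Qed.

Lemma dotZl c u v : dot (c *: u) v = c * dot u v.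
Proof. by rewrite mulr_sumr; apply: eq_bigr => i _; rewrite mxE mulrA. Qed.

Lemma dotNl u v : dot (- u) v = - dot u v.
Proof. by rewrite -scaleN1r dotZl mulN1r. Qed.

Lemma dotDr u v w : dot u (v + w) = dot u v + dot u w.
Proof. by rewrite dotC dotDl !(dotC u). Qed.

Lemma dotZr c u v : dot u (c *: v) = c * dot u v.
Proof. by rewrite dotC dotZl dotC. Qed.

Lemma dotNr u v : dot u (- v) = - dot u v.
Proof. by rewrite dotC dotNl dotC. Qed.

Definition dotE := (dotDl, dotDr, dotZl, dotZr, dotNl, dotNr).

Lemma sqnorm_ge0 u : 0 <= sqnorm u.
Proof. by apply: sumr_ge0 => i _; rewrite -expr2 sqr_ge0. Qed.

Lemma sqnorm0 : sqnorm (0 : 'rV[R]_p) = 0.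
Proof. by rewrite /sqnorm /dot big1// => i _; rewrite mxE mul0r. Qed.

Lemma sqnorm_eq0 u : sqnorm u <= 0 -> u = 0.
Proof.
move=> u0; have /eqP : sqnorm u = 0 by apply/le_anti; rewrite u0 sqnorm_ge0.
rewrite psumr_eq0 => [/allP u_eq0|i _]; last by rewrite -expr2 sqr_ge0.
apply/rowP => i; rewrite mxE; apply/eqP.
by have := u_eq0 i (mem_index_enum i); rewrite mulf_eq0 orbb.
Qed.

Lemma sqr_coord_le_sqnorm u i : u 0 i ^+ 2 <= sqnorm u.
Proof.
rewrite /sqnorm /dot (bigD1 i)//= -expr2 lerDl.
by apply: sumr_ge0 => j _; rewrite -expr2 sqr_ge0.
Qed.

Lemma sqnormZ c u : sqnorm (c *: u) = c ^+ 2 * sqnorm u.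
Proof. by rewrite /sqnorm !dotE; ring. Qed.

Lemma sqnormN u : sqnorm (- u) = sqnorm u.
Proof. by rewrite /sqnorm !dotE; ring. Qed.

Lemma sqnormD u v : sqnorm (u + v) = sqnorm u + 2 * dot u v + sqnorm v.
Proof. by rewrite /sqnorm !dotE (dotC v u); ring. Qed.

Lemma sqnormB u v : sqnorm (u - v) = sqnorm u - 2 * dot u v + sqnorm v.
Proof. by rewrite sqnormD dotNr sqnormN; ring. Qed.

Lemma sqnormD_le u v : sqnorm (u + v) <= 2 * sqnorm u + 2 * sqnorm v.
Proof.
by have := sqnorm_ge0 (u - v); rewrite sqnormB sqnormD; lra.
Qed.

Lemma young c u v : 0 < c -> dot u v <= c / 2 * sqnorm u + (2 * c)^-1 * sqnorm v.
Proof.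
move=> c0; have := sqnorm_ge0 (c *: u - v).
rewrite sqnormB sqnormZ dotZl => h.
rewrite -(ler_pM2l (mulr_gt0 (ltr0Sn R 1) c0)).
have -> : 2 * c * (c / 2 * sqnorm u + (2 * c)^-1 * sqnorm v) =
  c ^+ 2 * sqnorm u + sqnorm v by field; rewrite gt_eqF.
lra.
Qed.

Lemma enorm_ler_sqnorm c u v : 0 <= c -> enorm u <= c * enorm v ->
  sqnorm u <= c ^+ 2 * sqnorm v.
Proof.
move=> c0 uv; rewrite -(sqr_sqrtr (sqnorm_ge0 u)) -(sqr_sqrtr (sqnorm_ge0 v)).
rewrite -exprMn ler_sqr ?nnegrE ?sqrtr_ge0//.
by rewrite mulr_ge0 ?sqrtr_ge0.
Qed.

End Euclidean.

Lemma is_derive_quadratic (R : realType) (b c t : R) :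
  is_derive t (1 : R) (fun t => t * b + t ^+ 2 * c) (b + 2 * t * c).
Proof.
have d1 : is_derive t (1:R) (id : R -> R) 1 by exact: is_derive_id.
have cst' k : is_derive t (1 : R) (cst k : R -> R) 0 by exact: is_derive_cst.
have := is_deriveD (is_deriveM d1 (cst' b)) (is_deriveM (is_deriveM d1 d1) (cst' c)).
move=> h; apply: is_derive_eq h _.
by rewrite /GRing.scale/=; ring.
Qed.

(** * Smooth and strongly convex functions *)

Section Smooth.
Context {R : realType} {p : nat} (f : 'rV[R]_p -> R).
Implicit Types (x y v : 'rV[R]_p).

Lemma derive_gradient x v : differentiable f x ->
  'D_v f x = dot (gradient f x) v.
Proof.
move=> df; rewrite deriveE// {1}(row_sum_delta v) linear_sum.
apply: eq_bigr => i _; rewrite linearZ mxE deriveE//=; exact: mulrC.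
Qed.

Lemma is_derive_line x v t : differentiable f (x + t *: v) ->
  is_derive t 1 (fun s : R => f (x + s *: v)) (dot (gradient f (x + t *: v)) v).
Proof.
move=> df; rewrite -derive_gradient//.
have E : (fun h : R => h^-1 *: (((fun s : R => f (x + s *: v)) \o shift t) (h *: 1)
    - f (x + t *: v))) =
  (fun h : R => h^-1 *: ((f \o shift (x + t *: v)) (h *: v) - f (x + t *: v))).
  apply/funext => h /=; congr (_ *: (f _ - _)).
  by rewrite -[h *: 1]/(h * 1) mulr1 scalerDl addrCA.
apply: DeriveDef; rewrite /derivable /derive /= E //.
exact: diff_derivable.
Qed.

(** Convexity on a segment controls only the points with 0 < t <= 1. Since the derivative exists, it
    equals its limit from the right, where the quotients are at most b + t c. *)
Lemma derive_le x v (b c : R) : derivable f x v ->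
  (forall t, 0 < t -> t <= 1 -> f (x + t *: v) - f x <= t * b + t ^+ 2 * c) ->
  'D_v f x <= b.
Proof.
move=> /cvg_ex[l fl] hb; rewrite /derive (cvg_lim _ fl)//.
have fl' := cvg_dnbhs_at_right fl.
have bl : (b + h * c) @[h --> 0^'+] --> b.
  apply: cvg_at_right_filter; rewrite -[X in _ --> X]addr0 -[X in _ --> _ + X](mul0r c).
  by apply: cvgD; [exact: cvg_cst|apply: cvgM; [exact: cvg_id|exact: cvg_cst]].
rewrite -(cvg_lim _ fl')// -[leRHS](cvg_lim _ bl)//.
apply: ler_lim; [by apply/cvg_ex; exists l|by apply/cvg_ex; exists b|].
near=> h.
have h0 : 0 < h by near: h; exact: nbhs_right_gt.
have h1 : h <= 1 by near: h; exact: nbhs_right_le.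
rewrite -[_ *: _]/(h^-1 * (f (h *: v + x) - f x)) -(ler_pM2l h0).
rewrite mulVKf ?gt_eqF// [h *: v + x]addrC.
by apply: le_trans (hb h h0 h1) _; rewrite le_eqVlt; apply/orP; left; apply/eqP; ring.
Unshelve. all: by end_near. Qed.

(** Divide the convexity inequality by t and let t tend to 0; the factor t (1 - t) leaves the full
    mu / 2 in the limit. *)
Lemma strongly_convex_ge (mu : R) x y : strongly_convex mu f ->
  differentiable f x ->
  f x + dot (gradient f x) (y - x) + mu / 2 * sqnorm (y - x) <= f y.
Proof.
move=> sc df; rewrite -derive_gradient//.
have := @derive_le x (y - x) (f y - f x - mu / 2 * sqnorm (y - x))
  (mu / 2 * sqnorm (y - x)) (diff_derivable df) _.
suff H t : 0 < t -> t <= 1 -> f (x + t *: (y - x)) - f x <=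
   t * (f y - f x - mu / 2 * sqnorm (y - x)) + t ^+ 2 * (mu / 2 * sqnorm (y - x)).
  by move=> /(_ H); lra.
move=> t0 t1; have := sc y x t (ltW t0) t1.
have -> : t *: y + (1 - t) *: x = x + t *: (y - x).
  by apply/rowP => i; rewrite !mxE; ring.
lra.
Qed.

Variable L : R.
Hypotheses (L0 : 0 < L) (fL : smooth L f).

Lemma smooth_sqnorm x y :
  sqnorm (gradient f x - gradient f y) <= L ^+ 2 * sqnorm (x - y).
Proof. by apply: enorm_ler_sqnorm; [exact: ltW|exact: fL.2]. Qed.

Lemma smooth_monotone x v t : 0 <= t ->
  dot (gradient f (x + t *: v)) v <= dot (gradient f x) v + L * t * sqnorm v.
Proof.
rewrite le_eqVlt => /predU1P[<-|t0]; first by rewrite scale0r addr0; lra.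
have := smooth_sqnorm (x + t *: v) x.
rewrite [x + _ - x]addrAC subrr add0r sqnormZ; set u := _ - _ => hu.
have Lt0 : 0 < L * t by rewrite mulr_gt0.
have Lti0 : 0 < (L * t)^-1 by rewrite invr_gt0.
(* Young's inequality stands in for Cauchy-Schwarz: with weight 1 / (L t) each of its two terms is
   at most L t |v|^2 / 2. *)
have := young u v Lti0.
have -> : dot u v = dot (gradient f (x + t *: v)) v - dot (gradient f x) v.
  by rewrite dotDl dotNl.
have -> : (2 * (L * t)^-1)^-1 = L * t / 2 by field; rewrite !gt_eqF.
have : (L * t)^-1 / 2 * sqnorm u <= L * t / 2 * sqnorm v.
  apply: (@le_trans _ _ ((L * t)^-1 / 2 * (L ^+ 2 * (t ^+ 2 * sqnorm v)))).
    by rewrite ler_pM2l// divr_gt0.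
  by rewrite le_eqVlt; apply/orP; left; apply/eqP; field; rewrite !gt_eqF.
lra.
Qed.

(** Mean value theorem on [0, 1] for f along the segment minus the parabola t b + t^2 c, whose
    difference has nonpositive derivative by [smooth_monotone]. *)
Lemma descent x y :
  f y <= f x + dot (gradient f x) (y - x) + L / 2 * sqnorm (y - x).
Proof.
set v := y - x; set b := dot _ v; set c := L / 2 * _.
pose h (t : R) := f (x + t *: v) - (t * b + t ^+ 2 * c).
pose dh (t : R) := dot (gradient f (x + t *: v)) v - (b + 2 * t * c).
have hd t : is_derive t (1 : R) h (dh t).
  exact: is_deriveB (is_derive_line (fL.1 _)) (is_derive_quadratic b c t).
have [] := @MVT R h dh 0 1 ltr01 (fun t _ => hd t).
  by apply: derivable_within_continuous => t _; exact: (@ex_derive _ _ _ _ _ _ _ (hd t)).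
move=> t; rewrite in_itv/= => /andP[t0 t1].
rewrite /h scale1r scale0r subr0 /v subrKC addr0.
have := smooth_monotone x v (ltW t0).
rewrite /dh -/b -/v.
have -> : L * t * sqnorm v = 2 * t * c by rewrite /c; field.
lra.
Qed.

End Smooth.

(** The first-order condition along a segment, in a form that applies to the nonsmooth psi: divide
    by t and let t tend to 0. *)
Lemma slope_ge0 (R : realType) (a c : R) :
  (forall t, 0 < t -> t <= 1 -> 0 <= t * a + t ^+ 2 * c) -> 0 <= a.
Proof.
move=> h; apply/ler_addgt0Pr => e e0.
have c1 : 0 < `|c| + 1 by rewrite ltr_wpDl.
pose t := Num.min 1 (e / (`|c| + 1)).
have t0 : 0 < t by rewrite lt_min ltr01 divr_gt0.
have t1 : t <= 1 by rewrite ge_min lexx.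
have te : t * (`|c| + 1) <= e by rewrite -ler_pdivlMr// ge_min lexx orbT.
have := h t t0 t1; rewrite expr2 -mulrA -mulrDr pmulr_rge0// => /le_trans; apply.
by rewrite lerD2l (le_trans _ te)// ler_pM2l// (le_trans (ler_norm c))// lerDl.
Qed.

Lemma sqnorm_continuous (R : realType) p (u : 'rV[R]_p) :
  continuous (fun y : 'rV[R]_p => sqnorm (y - u) : R).
Proof.
have h i : continuous (fun y : 'rV[R]_p => (y - u) 0 i).
  rewrite (_ : (fun y => _) = (fun y : 'rV[R]_p => y 0 i) \- cst (u 0 i)).
    by move=> y; apply: (@continuousB R R^o); [exact: coord_continuous|exact: cst_continuous].
  by apply/funext => y; rewrite !mxE.
apply: continuous_big => [|i _ y]; first exact: add_continuous.
by apply: continuousM; exact: h.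
Qed.

Lemma bounded_sqnorm_le (R : realType) p (u : 'rV[R]_p) (M : R) :
  bounded_set [set y | sqnorm (y - u) <= M].
Proof.
exists (`|u| + (M + 1)); split; first exact: num_real.
move=> N hN y /= yM; apply: le_trans (ltW hN).
have M0 : 0 <= M by apply: le_trans yM; exact: sqnorm_ge0.
rewrite -[y](subrK u) addrC (le_trans (ler_normD _ _))// lerD2l.
rewrite [leLHS]/Num.norm/= mx_normrE; apply/bigmax_leP; split => [|[i j] _].
  by rewrite addr_ge0.
rewrite (ord1 i) /=.
have := le_trans (sqr_coord_le_sqnorm (y - u) j) yM.
rewrite -real_normK ?num_real//; set a := `|_|.
(* From 2 a <= a^2 + 1 and a^2 <= M the sup-norm bound M + 1 follows. *)
by have := sqr_ge0 (a - 1); nra.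
Qed.

(** * Proximal operators *)

Section Prox.
Context {R : realType} {p : nat} (psi : 'rV[R]_p -> \bar R).
Implicit Types (x y z u v : 'rV[R]_p) (s : R).
Hypotheses (psi_proper : proper_efun psi) (psi_convex : econvex psi).

Lemma efun_fin_num y : (psi y < +oo)%E -> psi y \is a fin_num.
Proof. by move=> h; rewrite fin_numE psi_proper.1/= lt_eqF. Qed.

Lemma econvex_fin x y t : psi x \is a fin_num -> psi y \is a fin_num ->
  0 <= t -> t <= 1 ->
  psi (x + t *: (y - x)) \is a fin_num /\
  fine (psi (x + t *: (y - x))) <= t * fine (psi y) + (1 - t) * fine (psi x).
Proof.
move=> px py t0 t1; have := psi_convex y x t0 t1.
have -> : t *: y + (1 - t) *: x = x + t *: (y - x).
  by apply/rowP => i; rewrite !mxE; ring.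
rewrite -[in X in (_ <= X)%E](fineK px) -[in X in (_ <= X)%E](fineK py).
rewrite -!EFinM -EFinD => h.
have pf : psi (x + t *: (y - x)) \is a fin_num.
  by apply: efun_fin_num; apply: le_lt_trans h _; rewrite ltry.
by split => //; rewrite -lee_fin fineK.
Qed.

Section minorant.
Variables (f : 'rV[R]_p -> R) (L : R) (xstar : 'rV[R]_p).
Hypotheses (L0 : 0 < L) (fL : smooth L f).
Hypothesis xstar_min : argmin (composite f psi) xstar.

Lemma argmin_fin_num : psi xstar \is a fin_num.
Proof.
have [y] := psi_proper.2; rewrite -ltey => py.
have := xstar_min y; rewrite /composite => h.
apply: efun_fin_num; move: h; have := psi_proper.1 xstar.
case: (psi xstar) => // [r _ _|_]; first by rewrite ltry.
by rewrite addey// leye_eq; move: py; case: (psi y).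
Qed.

(** Moving from xstar towards y changes f by at most a linear term plus O(t^2), by [descent], and
    psi by at most t times its increment, by convexity; optimality and [slope_ge0] conclude. *)
Lemma argmin_subgradient y :
  ((fine (psi xstar) - dot (gradient f xstar) (y - xstar))%:E <= psi y)%E.
Proof.
have pstar := argmin_fin_num.
have [py|] := boolP (psi y \is a fin_num); last first.
  by rewrite fin_numE psi_proper.1/= negbK => /eqP ->; rewrite leey.
rewrite -(fineK py) lee_fin -subr_ge0.
apply: (@slope_ge0 _ _ (L / 2 * sqnorm (y - xstar))) => t t0 t1.
have [pt] := econvex_fin pstar py (ltW t0) t1.
have := xstar_min (xstar + t *: (y - xstar)).
rewrite /composite -(fineK pstar) -(fineK pt) -!EFinD lee_fin.
have := descent L0 fL xstar (xstar + t *: (y - xstar)).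
rewrite [xstar + _ - xstar]addrAC subrr add0r dotZr sqnormZ; nra.
Qed.

End minorant.

Hypothesis psi_lsc : lower_semicontinuous psi.
Variables (a : 'rV[R]_p) (b : R).
Hypothesis psi_ge : forall y, ((b + dot a y)%:E <= psi y)%E.

Local Notation prox_obj s u :=
  (fun y => (s%:E * psi y + (2^-1 * sqnorm (y - u))%:E)%E).

(** Coercivity: Young's inequality with weight 2 absorbs the linear part of the minorant into half
    of the quadratic, hence the remaining 1/4. *)
Lemma prox_obj_ge s u y : 0 < s ->
  ((s * b + s * dot a u - sqnorm (s *: a) + 4^-1 * sqnorm (y - u))%:E
    <= prox_obj s u y)%E.
Proof.
move=> s0.
have h1 : ((s * (b + dot a y))%:E <= s%:E * psi y)%E.
  by rewrite EFinM lee_pmul2l ?lte_fin.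
apply: le_trans (leeD2r _ h1); rewrite -EFinD lee_fin.
have := young (- (s *: a)) (y - u) (ltr0Sn R 1).
rewrite sqnormN dotNl dotZl dotDr dotNr.
have -> : (2 * 2 : R)^-1 = 4^-1 by congr _^-1; ring.
lra.
Qed.

Lemma lower_semicontinuous_prox_obj s u : 0 < s ->
  lower_semicontinuous (prox_obj s u).
Proof.
move=> s0 z c; rewrite -lteBlDr// => h.
(* The level [r] splits the strict inequality into one for psi, stable by semicontinuity, and one
   for the quadratic, stable by continuity. *)
have [r [cr rz]] : exists r, c - 2^-1 * sqnorm (z - u) < s * r /\ (r%:E < psi z)%E.
  move: h; case: (psi z) (psi_proper.1 z) => // [q|] _.
    rewrite -EFinM lte_fin; set c' := c - _ => h.
    exists ((c' / s + q) / 2); rewrite lte_fin.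
    have : c' / s < q by rewrite ltr_pdivrMr// mulrC.
    split; last lra.
    by rewrite mulrC -ltr_pdivrMr//; lra.
  move=> _; set c' := c - _; exists (c' / s + 1); split; last by rewrite ltry.
  by rewrite mulrDr mulrCA divff ?gt_eqF// !mulr1 ltrDl.
have [V Vz Vr] := psi_lsc rz.
have Wz : nbhs z [set y | c - s * r < 2^-1 * sqnorm (y - u)].
  have : {for z, continuous (fun y : 'rV[R]_p => 2^-1 * sqnorm (y - u) : R)}.
    by apply: continuousM; [exact: cst_continuous|exact: sqnorm_continuous].
  by move/cvgr_gt; apply; lra.
exists (V `&` [set y | c - s * r < 2^-1 * sqnorm (y - u)]).
  exact: filterI.
move=> y [/Vr ry] /= cy.
have : ((s * r)%:E < s%:E * psi y)%E by rewrite EFinM lte_pmul2l ?lte_fin.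
case: (psi y) (psi_proper.1 y) => [q _|_|/eqP//].
  by rewrite -!EFinM -!EFinD !lte_fin; clear -cy; lra.
by move=> _; rewrite gt0_muley ?lte_fin// addye// ltry.
Qed.

(** Direct method: a minimizing sequence stays in a compact set, and lower semicontinuity at a
    cluster point z excludes a value above the infimum. *)
Lemma prox_obj_has_min s u y0 : 0 < s -> psi y0 \is a fin_num ->
  exists x, argmin (prox_obj s u) x.
Proof.
move=> s0 py0.
set h := prox_obj s u.
set m0 := s * b + s * dot a u - sqnorm (s *: a).
have hge y : ((m0 + 4^-1 * sqnorm (y - u))%:E <= h y)%E by exact: prox_obj_ge.
pose m := ereal_inf (range h).
have m0m : (m0%:E <= m)%E.
  apply: le_ereal_inf_tmp => _ [y _ <-]; apply: le_trans (hge y).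
  by rewrite lee_fin lerDl mulr_ge0 ?sqnorm_ge0.
have mfin : m \is a fin_num.
  rewrite fin_numElt (lt_le_trans _ m0m) ?ltNyr//=.
  apply: (@le_lt_trans _ _ (h y0)); first by apply: ereal_inf_lbound; exists y0.
  by rewrite /h -(fineK py0) -EFinM -EFinD ltry.
have /choice[y hy] n : exists y, (h y < m + (n.+1%:R^-1)%:E)%E.
  have [|_ [y _ <-] ?] := @lb_ereal_inf_adherent _ (range h) n.+1%:R^-1 _ mfin.
    by rewrite invr_gt0.
  by exists y.
(* The radius comes from m0 + |y_n - u|^2 / 4 <= h(y_n) < m + 1. *)
pose K := [set y | sqnorm (y - u) <= 4 * (fine m + 1 - m0)].
have Kc : compact K.
  apply: bounded_closed_compact; first exact: bounded_sqnorm_le.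
  apply: (@closed_comp _ _ (fun y => sqnorm (y - u)) [set r | r <= _]).
    by move=> ? _; exact: sqnorm_continuous.
  exact: closed_le.
have yK n : K (y n).
  have := le_lt_trans (hge (y n)) (hy n).
  rewrite -(fineK mfin) -EFinD lte_fin /K/=.
  have : (n.+1%:R^-1 : R) <= 1 by rewrite invf_le1 ?ler1n.
  by move: (n.+1%:R^-1) (fine m) (m0) (sqnorm _) => i' m' m0' q; lra.
have [|z [Kz cz]] := Kc (y @ \oo) _; first by exists 0%N => // n _; exact: yK.
suff hz : (h z <= m)%E.
  by exists z => w; apply: le_trans hz _; apply: ereal_inf_lbound; exists w.
rewrite leNgt; apply/negP; rewrite -(fineK mfin) => mz.
have [c [mc cz']] : exists c, fine m < c /\ (c%:E < h z)%E.
  move: mz; case: (h z) => // [r|_].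
    by rewrite lte_fin => mr; exists ((fine m + r) / 2); rewrite lte_fin; split; lra.
  by exists (fine m + 1); rewrite ltry; split; lra.
have [V Vz Vh] := lower_semicontinuous_prox_obj s0 cz'.
have [n cn] : exists n, n.+1%:R^-1 < c - fine m.
  exists (Num.truncn (c - fine m)^-1).
  rewrite invf_plt ?posrE ?subr_gt0 ?ltr0n//.
  exact: truncnS_gt.
have : (y @ \oo) [set x | (h x < c%:E)%E].
  exists n => // k /= nk; apply: lt_trans (hy k) _.
  rewrite -(fineK mfin) -EFinD lte_fin -ltrBrDl; apply: le_lt_trans cn.
  by rewrite lef_pV2 ?posrE ?ltr0n// ler_nat.
move=> /cz /(_ Vz)[w [/= wc /Vh]]; rewrite -/(h w) => cw.
by have := lt_trans wc cw; rewrite ltxx.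
Qed.

Hypothesis psi_dom : exists y, psi y \is a fin_num.

Lemma proxP s u : 0 < s -> argmin (prox_obj s u) (prox s psi u).
Proof.
move=> s0; have [y0 py0] := psi_dom.
have [x hx] := prox_obj_has_min u s0 py0; exact: (xgetI 0 hx).
Qed.

Lemma prox_fin_num s u : 0 < s -> psi (prox s psi u) \is a fin_num.
Proof.
move=> s0; have [y0 py0] := psi_dom; have /(_ y0) := proxP u s0.
rewrite -(fineK py0) -EFinM -EFinD => h; apply: efun_fin_num.
move: h; case: (psi _) (psi_proper.1 (prox s psi u)) => // [r _ _|_].
  by rewrite ltry.
by rewrite gt0_muley ?lte_fin// addye.
Qed.

(** The residual (u - prox) / s is a subgradient of psi at the proximal point: compare the objective
    there with its values on the segment towards y. *)
Lemma prox_variational s u y : 0 < s -> psi y \is a fin_num ->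
  s * fine (psi (prox s psi u)) + dot (u - prox s psi u) (y - prox s psi u)
    <= s * fine (psi y).
Proof.
move=> s0 py; have := prox_fin_num u s0; have := proxP u s0.
set x := prox s psi u => xmin px.
rewrite -subr_ge0; apply: (@slope_ge0 _ _ (2^-1 * sqnorm (y - x))) => t t0 t1.
have [pt pt'] := econvex_fin px py (ltW t0) t1.
have := xmin (x + t *: (y - x)).
rewrite -(fineK px) -(fineK pt) -!EFinM -!EFinD lee_fin /=.
have -> : x + t *: (y - x) - u = (x - u) + t *: (y - x) by rewrite addrAC.
rewrite (sqnormD (x - u)) dotZr sqnormZ.
have -> : dot (u - x) (y - x) = - dot (x - u) (y - x) by rewrite -dotNl opprB.
have := ler_wpM2l (ltW s0) pt'; lra.
Qed.

Lemma prox_three_point s u y : 0 < s -> psi y \is a fin_num ->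
  s * fine (psi (prox s psi u)) + 2^-1 * sqnorm (prox s psi u - u)
    + 2^-1 * sqnorm (y - prox s psi u)
    <= s * fine (psi y) + 2^-1 * sqnorm (y - u).
Proof.
move=> s0 py; have := prox_variational u s0 py; set x := prox s psi u.
have -> : y - u = (y - x) - (u - x) by rewrite opprB addrA subrK.
rewrite (sqnormB (y - x)) -(sqnormN (u - x)) opprB (dotC (y - x)); lra.
Qed.

(** The variational inequalities of x and z, each tested at the other point, add up to monotonicity
    of the residuals; u - v is x - z plus the difference of the residuals. *)
Lemma prox_nonexpansive s u v : 0 < s ->
  sqnorm (prox s psi u - prox s psi v) <= sqnorm (u - v).
Proof.
move=> s0.
have := prox_variational u s0 (prox_fin_num v s0).
have := prox_variational v s0 (prox_fin_num u s0).
set x := prox s psi u; set z := prox s psi v => hv hu.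
have -> : u - v = (x - z) + ((u - x) - (v - z)).
  by apply/rowP => i; rewrite !mxE; ring.
rewrite (sqnormD (x - z)); set w := _ - (v - z).
suff : 0 <= dot (x - z) w by have := sqnorm_ge0 w; lra.
have -> : dot (x - z) w = - dot (u - x) (z - x) - dot (v - z) (x - z).
  by rewrite -dotNr opprB -dotNl -dotDl dotC.
lra.
Qed.

End Prox.

(** The upper and lower quadratic bounds at 0 are compared at a unit vector, which exists only in
    positive dimension. *)
Lemma strongly_convex_smooth_le (R : realType) p (f : 'rV[R]_p -> R) (L mu : R) :
  0 < L -> smooth L f -> strongly_convex mu f -> (0 < p)%N -> mu <= L.
Proof.
move=> L0 fL fmu p0; pose e : 'rV[R]_p := delta_mx 0 (Ordinal p0).
have e1 : sqnorm e = 1.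
  rewrite /sqnorm /dot (bigD1 (Ordinal p0))//= big1 => [|i ne].
    by rewrite mxE !eqxx mulr1 addr0.
  by rewrite mxE (negbTE ne) mulr0.
have := strongly_convex_ge e fmu (fL.1 0); have := descent L0 fL 0 e.
rewrite subr0 e1; lra.
Qed.

(* With L <= mu the strong monotonicity and the Lipschitz bounds meet, and the
   gradient step of length 1 / mu is constant. *)
Lemma gradient_step_constant (R : realType) p (f : 'rV[R]_p -> R) (L mu s : R) :
  0 < L -> smooth L f -> strongly_convex mu f -> 0 < s -> s * L <= 1 ->
  mu * s = 1 -> forall x y, x - s *: gradient f x = y - s *: gradient f y.
Proof.
move=> L0 fL fmu s0 sL ms x y; apply/eqP; rewrite -subr_eq0; apply/eqP.
apply: sqnorm_eq0.
have hx := strongly_convex_ge x fmu (fL.1 y).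
have hy := strongly_convex_ge y fmu (fL.1 x).
have hs := smooth_sqnorm L0 fL x y.
have -> : x - s *: gradient f x - (y - s *: gradient f y) =
    (x - y) - s *: (gradient f x - gradient f y).
  by apply/rowP => i; rewrite !mxE; ring.
rewrite (sqnormB (x - y)) dotZr sqnormZ.
rewrite -(sqnormN (y - x)) opprB in hy.
have -> : dot (x - y) (gradient f x - gradient f y) =
    - dot (gradient f x) (y - x) - dot (gradient f y) (x - y).
  by rewrite -dotNr opprB -dotNl -dotDl dotC.
have sL2 : s ^+ 2 * L ^+ 2 <= 1.
  by rewrite -exprMn expr_le1// mulr_ge0// ltW.
have := ler_wpM2l (sqr_ge0 s) hs; rewrite mulrA => h1.
have := ler_wpM2r (sqnorm_ge0 (x - y)) sL2; rewrite mul1r => h2.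
have h3 : mu * s * sqnorm (x - y) = sqnorm (x - y) by rewrite ms mul1r.
have := ler_wpM2l (ltW s0) (lerD hx hy).
lra.
Qed.

(** * Step-size parameters *)

Section StepSizes.
Context {R : realType} (mu : R) (eta gamma delta : nat -> R).
Hypothesis par : parameters mu eta gamma delta.
Hypothesis mu_eta : forall k, mu * eta k.+1 <= 1.

(** The implicit recursion solves to gamma_(k+1) = gamma_k / (1 + eta (gamma_k - mu)), with
    denominator at least 1 by induction. *)
Lemma parameters_gamma k : mu <= gamma k /\ 0 < gamma k.
Proof.
have [mu0 gamma0 eta0 deltaE gammaE] := par.
elim: k => [//|k [mug g0]].
have := eta0 k; have := mu_eta k; have := gammaE k; rewrite deltaE.
move: (gamma k.+1) (eta k.+1) => g e gE mue e0.
have d0 : 0 < 1 + e * (gamma k - mu).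
  by rewrite ltr_pwDl// mulr_ge0 ?(ltW e0)// subr_ge0.
have g'E : g * (1 + e * (gamma k - mu)) = gamma k by lra.
split; last by rewrite -(pmulr_lgt0 _ d0) g'E.
rewrite -subr_ge0 -(pmulr_lge0 _ d0) mulrBl g'E.
have -> : gamma k - mu * (1 + e * (gamma k - mu)) = (gamma k - mu) * (1 - mu * e) by ring.
by rewrite mulr_ge0// subr_ge0.
Qed.

(** All is read off (1 - delta) (1 + eta (gamma_k - mu)) = 1 - mu eta, where the second factor is
    positive. *)
Lemma parameters_delta k :
  [/\ 0 < delta k.+1, delta k.+1 <= 1 & delta k.+1 = 1 -> mu * eta k.+1 = 1].
Proof.
have [mu0 gamma0 eta0 deltaE gammaE] := par.
have [mug g0] := parameters_gamma k; have [_ g0'] := parameters_gamma k.+1.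
have := eta0 k; have := mu_eta k; have := gammaE k; rewrite deltaE.
move: (gamma k.+1) g0' (eta k.+1) => g g0' e gE mue e0.
have d0 : 0 < 1 + e * (gamma k - mu).
  by rewrite ltr_pwDl// mulr_ge0 ?(ltW e0)// subr_ge0.
have dE : (1 - e * g) * (1 + e * (gamma k - mu)) = 1 - mu * e.
  by have := congr1 ( *%R e) gE; lra.
split; first exact: mulr_gt0.
- by rewrite -subr_ge0 -(pmulr_lge0 _ d0) dE subr_ge0.
- by move=> eg1; move: dE; rewrite eg1 subrr mul0r; lra.
Qed.

End StepSizes.

(** One deterministic step for both algorithms: x is the old iterate, z the new one, w its noiseless
    counterpart and y plays xstar; d, dm and d', dm' are the values at y and the minima of the old
    and new surrogates. *)
Lemma surrogate_step (R : realType) p (f : 'rV[R]_p -> R) (L mu delta eta gamma : R)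
    (x g y z w : 'rV[R]_p) (psiy psiz d dm d' dm' : R) :
  0 < L -> smooth L f -> strongly_convex mu f ->
  0 < delta -> 0 < eta -> eta * L <= 1 -> 0 < gamma -> delta = eta * gamma ->
  d' <= (1 - delta) * d + delta * (quad_model mu f x g y + psiy) ->
  (1 - delta) * dm + gamma / 2 * sqnorm (z - x)
    + delta * (f x + dot g (z - x) + psiz) <= dm' ->
  sqnorm (w - z) <= eta ^+ 2 * sqnorm (g - gradient f x) ->
  delta * (f z + psiz - (f y + psiy)) + (d' - dm') <=
    (1 - delta) * (d - dm) +
    (delta * eta * sqnorm (g - gradient f x)
     + delta * dot (g - gradient f x) (y - w)).
Proof.
move=> L0 fL fmu delta0 eta0 etaL gamma0 deltaE hd' hdm' wz.
have hsc := strongly_convex_ge y fmu (fL.1 x).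
have hds := descent L0 fL x z.
set n := g - gradient f x in wz *.
have gE v : dot g v = dot (gradient f x) v + dot n v.
  by rewrite /n dotDl dotNl; ring.
rewrite /quad_model gE in hd'; rewrite gE in hdm'.
have hyz : dot n (y - x) - dot n (z - x) = dot n (y - w) + dot n (w - z).
  by rewrite -dotNr -!dotDr; congr dot; apply/rowP => i; rewrite !mxE; ring.
(* The weight eta balances Young's inequality, since |w - z| <= eta |n|. *)
have hw : dot n (w - z) <= eta * sqnorm n.
  have := young n (w - z) eta0.
  have : (2 * eta)^-1 * sqnorm (w - z) <= eta / 2 * sqnorm n.
    rewrite -(ler_pM2l (mulr_gt0 (ltr0Sn R 1) eta0)) mulrA divff ?gt_eqF ?mulr_gt0//.
    lra.
  lra.
(* The growth of the surrogate pays for the curvature of f: delta L = eta L gamma <= gamma. *)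
have dL : delta * (L / 2 * sqnorm (z - x)) <= gamma / 2 * sqnorm (z - x).
  rewrite deltaE mulrA ler_wpM2r ?sqnorm_ge0//.
  by have := ler_wpM2r (ltW gamma0) etaL; lra.
have := ler_wpM2l (ltW delta0) hsc.
have := ler_wpM2l (ltW delta0) hds.
have := ler_wpM2l (ltW delta0) hw.
have : delta * (dot n (y - x) - dot n (z - x)) = delta * (dot n (y - w) + dot n (w - z)).
  by rewrite hyz.
lra.
Qed.

(** * Measurability and integration *)

Section Integral.
Context d (T : measurableType d) (R : realType) (mu : {measure set T -> \bar R}).
Local Open Scope ereal_scope.

(* The integral of any nonnegative function is a supremum over the simple functions
   below it, hence monotone even outside the measurable functions. *)
Lemma ge0_le_integral_nomeas (f g : T -> \bar R) :
  (forall x, 0 <= f x) -> (forall x, f x <= g x) ->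
  \int[mu]_x f x <= \int[mu]_x g x.
Proof.
move=> f0 fg; rewrite !ge0_integralTE//; last first.
  by move=> x; exact: le_trans (f0 x) (fg x).
apply: ereal_sup_le => _ [h hf <-]; exists h => // x.
exact: le_trans (hf x) (fg x).
Qed.

Lemma le_integral_nomeas (f g : T -> \bar R) : (forall x, f x <= g x) ->
  \int[mu]_x f x <= \int[mu]_x g x.
Proof.
move=> fg; rewrite (integralE _ _ f) (integralE _ _ g); apply: leeB.
  apply: ge0_le_integral_nomeas => x; first exact: funepos_ge0.
  by rewrite !funeposE ge_max !le_max fg lexx orbT.
apply: ge0_le_integral_nomeas => x; first exact: funeneg_ge0.
by rewrite !funenegE ge_max !le_max leeN2 fg lexx orbT.
Qed.

End Integral.

(** * Centered variables against a sub-sigma-algebra *)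

Section SubSigmaAlgebra.
Context d (T : measurableType d) (R : realType) (P : probability T R).
Variable G : set (set T).
Hypotheses (sG : sigma_algebra setT G) (GT : G `<=` measurable).

Local Notation TG := (g_sigma_algebraType G).

Lemma measurable_sub (A : set T) : measurable (A : set TG) -> G A.
Proof. by rewrite measurable_g_measurableTypeE. Qed.

Lemma measurable_fun_sub d' (U : measurableType d') (X : T -> U) :
  measurable_fun [set: TG] X -> measurable_fun [set: T] X.
Proof. by move=> mX _ B mB; apply: GT; apply: measurable_sub; exact: mX. Qed.

Variable X : T -> R.
Hypothesis iX : P.-integrable setT (EFin \o X).
Hypothesis X0 : forall A, G A -> (\int[P]_(w in A) (X w)%:E = 0)%E.

Let mX : measurable_fun setT X.
Proof. exact/measurable_EFinP/(measurable_int P). Qed.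

Import HBNNSimple.

(** A simple function is a finite combination of indicators of its level sets, which lie in G, and X
    integrates to 0 over each. *)
Lemma integral_centered_nnsfun (h : {nnsfun TG >-> R}) :
  (\int[P]_w (X w * h w)%:E = 0)%E.
Proof.
have mh y : G (h @^-1` [set y]) by apply: measurable_sub.
transitivity (\int[P]_w (\sum_(y <- finmap.enum_fset (fset_set (range h)))
    y%:E * (X w * \1_(h @^-1` [set y]) w)%:E)%E)%E.
  apply: eq_integral => w _; rewrite fimfunE fsbig_finite//= mulr_sumr -sumEFin.
  by apply: eq_bigr => y _; rewrite -EFinM mulrCA.
have iXh y : P.-integrable setT (fun w => (X w * \1_(h @^-1` [set y]) w)%:E).
  apply: (le_integrable measurableT _ _ iX).
    apply/measurable_EFinP; apply: measurable_funM => //.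
    by apply: measurable_indic; exact: GT.
  move=> w _ /=; rewrite lee_fin normrM indicE.
  by case: (_ \in _); rewrite ?normr1 ?normr0 ?mulr1 ?mulr0.
rewrite integral_sum//; last by move=> y; exact: integrableZl.
rewrite big1// => y _; rewrite integralZl//.
rewrite (_ : \int[P]_w _ = \int[P]_(w in h @^-1` [set y]) (X w)%:E)%E; last first.
  rewrite [RHS]integral_mkcond; apply: eq_integral => w _.
  by rewrite /patch indicE; case: ifP => _; rewrite ?mulr1 ?mulr0.
by rewrite X0// mule0.
Qed.

(** Approximate Z from below by G-simple functions and use dominated convergence; |X Z| itself
    dominates, so Z may be unbounded. *)
Lemma integral_centered_nneg (Z : T -> R) : measurable_fun [set: TG] Z ->
  (forall w, 0 <= Z w) -> P.-integrable setT (fun w => (X w * Z w)%:E) ->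
  (\int[P]_w (X w * Z w)%:E = 0)%E.
Proof.
move=> mZ Z0 iXZ.
have mZE : measurable_fun [set: TG] (EFin \o Z) by exact/measurable_EFinP.
pose h := nnsfun_approx measurableT mZE.
have hZ w : (fun n => h n w) @ \oo --> Z w.
  have := @cvg_nnsfun_approx _ TG R _ measurableT _ mZE (fun w _ => Z0 w) w I.
  by move/fine_cvgP => [_].
have hle n w : h n w <= Z w.
  rewrite -(cvg_lim _ (hZ w))//; apply: nondecreasing_cvgn_le; last exact: cvgP (hZ w).
  by move=> k m km; exact/lefP/nd_nnsfun_approx.
have mh n : measurable_fun setT (h n : T -> R) by exact/measurable_fun_sub.
have mZT := measurable_fun_sub mZ.
have [] := @dominated_convergence _ _ R P setT measurableT
  (fun n w => (X w * h n w)%:E) (fun w => (X w * Z w)%:E) (fun w => `|(X w * Z w)%:E|%E).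
- by move=> n; apply/measurable_EFinP; exact: measurable_funM.
- by apply/measurable_EFinP; exact: measurable_funM.
- apply: aeW => w _; apply: cvg_EFin; first exact: nearW.
  by apply: cvgM; [exact: cvg_cst|exact: hZ].
- exact: integrable_abse.
- apply: aeW => w n _ /=; rewrite lee_fin !normrM ler_wpM2l//.
  by rewrite !ger0_norm// fun_ge0.
move=> _ _ /cvg_lim <-//.
rewrite (_ : [sequence _]_n = cst 0%E) ?lim_cst//.
by apply/funext => n /=; exact: integral_centered_nnsfun.
Qed.

Lemma integral_centered (Z : T -> R) : measurable_fun [set: TG] Z ->
  P.-integrable setT (fun w => (X w * Z w)%:E) ->
  (\int[P]_w (X w * Z w)%:E = 0)%E.
Proof.
move=> mZ iXZ; have mZT := measurable_fun_sub mZ.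
(* The sign [s] treats the positive part ([false]) and the negative part ([true]) of Z at once. *)
have ip (s : bool) : let Zs := fun w => Num.max ((-1) ^+ s * Z w) 0 in
    measurable_fun [set: TG] Zs /\ P.-integrable setT (fun w => (X w * Zs w)%:E).
  have m' d' (T' : measurableType d') (Y : T' -> R) : measurable_fun setT Y ->
      measurable_fun setT (fun w => Num.max ((-1) ^+ s * Y w) 0).
    by move=> mY; apply: measurable_maxr => //; exact: measurable_funM.
  split; first exact: m'.
  apply: (le_integrable measurableT _ _ iXZ).
    by apply/measurable_EFinP; apply: measurable_funM => //; exact: m'.
  move=> w _ /=; rewrite lee_fin !normrM ler_wpM2l//.
  rewrite ger0_norm ?le_max ?lexx ?orbT// ge_max normr_ge0 andbT.
  by rewrite (le_trans (ler_norm _))// normrM normrX normrN1 expr1n mul1r.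
have [mp iXp] := ip false; have [mn iXn] := ip true.
rewrite (_ : (fun w => _) = ((fun w => (X w * Num.max ((-1) ^+ false * Z w) 0)%:E) \-
   (fun w => (X w * Num.max ((-1) ^+ true * Z w) 0)%:E))%E); last first.
  apply/funext => w /=; rewrite -EFinB -mulrBr expr0 expr1 mul1r mulN1r.
  by congr (_ * _)%:E; rewrite /Num.max; case: ltP => ?; case: ltP => ?; lra.
rewrite integralB// !integral_centered_nneg ?subee// => w.
  by rewrite le_max lexx orbT.
by rewrite le_max lexx orbT.
Qed.

End SubSigmaAlgebra.

(** * Measurability of random vectors *)

Section RowVectorMeasurability.
Context d (T : measurableType d) (R : realType) (p : nat).
Implicit Types X Y : T -> 'rV[R]_p.

(** Taken over [g_sigma_algebraType (Fil k)] in place of T, this expresses adaptedness to step k. *)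
Definition coord_measurable X := forall i, measurable_fun setT (fun w => X w 0 i).

Lemma coord_measurable_cst (a : 'rV[R]_p) : coord_measurable (fun=> a).
Proof. by move=> i; exact: measurable_cst. Qed.

Lemma coord_measurableD X Y : coord_measurable X -> coord_measurable Y ->
  coord_measurable (fun w => X w + Y w).
Proof.
by move=> mX mY i; under eq_fun do rewrite mxE; exact: measurable_funD.
Qed.

Lemma coord_measurableZ c X : coord_measurable X ->
  coord_measurable (fun w => c *: X w).
Proof.
by move=> mX i; under eq_fun do rewrite mxE; exact: measurable_funM.
Qed.

Lemma coord_measurableB X Y : coord_measurable X -> coord_measurable Y ->
  coord_measurable (fun w => X w - Y w).
Proof.
move=> mX mY; under eq_fun do rewrite -scaleN1r.
by apply: coord_measurableD => //; exact: coord_measurableZ.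
Qed.

Lemma measurable_dot X Y : coord_measurable X -> coord_measurable Y ->
  measurable_fun setT (fun w => dot (X w) (Y w)).
Proof. by move=> mX mY; apply: measurable_sum => i; exact: measurable_funM. Qed.

(* Row vectors carry no sigma-algebra in the library: open sets are countable
   unions of rational boxes. *)
Lemma coord_measurable_open X (B : set 'rV[R]_p) : coord_measurable X ->
  open B -> measurable (X @^-1` B).
Proof.
move=> mX oB.
pose box (qn : 'rV[rat]_p * nat) : set 'rV[R]_p :=
  [set y | forall i, ball (ratr (qn.1 0 i) : R) qn.2.+1%:R^-1 (y 0 i)].
have -> : X @^-1` B = \bigcup_(qn in [set: 'rV[rat]_p * nat])
    if `[< box qn `<=` B >] then X @^-1` box qn else set0.
  apply/seteqP; split => [w /= Bw|w [qn _]]; last by case: asboolP => // h /h.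
  have /nbhs_ballP[e /= e0 eB] : nbhs (X w) B by exact: open_nbhs_nbhs.
  have [n ne] : exists n, n.+1%:R^-1 + n.+1%:R^-1 < e.
    have := truncnS_gt (2 / e); move: (Num.truncn _) => n.
    rewrite ltr_pdivrMr// => h; exists n.
    rewrite (_ : _ + _ = 2 / n.+1%:R); last by ring.
    by rewrite ltr_pdivrMr ?ltr0n// mulrC.
  have /choice[q hq] (i : 'I_p) : exists q : rat,
      ball (X w 0 i) n.+1%:R^-1 (ratr q).
    have [|q] := @rat_in_itvoo R (X w 0 i) (X w 0 i + n.+1%:R^-1).
      by rewrite ltrDl invr_gt0.
    rewrite in_itv/= => /andP[q1 q2]; exists q.
    by rewrite /ball/= ltr0_norm ?subr_lt0// opprB ltrBlDl.
  exists (\row_i q i, n) => //; rewrite asboolT => [|y hy].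
    by move=> i; rewrite /= mxE; exact: ball_sym.
  apply: eB; split => // i j; rewrite (ord1 i); have := hy j; rewrite /= mxE => hj.
  by apply: le_ball (ltW ne) _ _; exact: ball_triangle (hq j) hj.
apply: countable_bigcupT_measurable => [|qn]; first exact: countableP.
case: asboolP => // _.
rewrite (_ : _ @^-1` _ = \bigcap_(i in [set: 'I_p])
    (fun w => X w 0 i) @^-1` ball (ratr (qn.1 0 i) : R) qn.2.+1%:R^-1).
  apply: fin_bigcap_measurable => // i _.
  by rewrite -[X in measurable X]setTI; apply: mX => //; exact: measurable_ball.
by apply/seteqP; split => [w h i _|w h i]; [exact: h|exact: (h i)].
Qed.

(** A nonexpansive map is continuous, so rays pull back to open sets. This gives the measurability
    of the proximal steps. *)
Lemma coord_measurable_comp X (phi : 'rV[R]_p -> 'rV[R]_p) :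
  (forall u v, sqnorm (phi u - phi v) <= sqnorm (u - v)) ->
  coord_measurable X -> coord_measurable (fun w => phi (X w)).
Proof.
move=> hphi mX i.
have cphi : continuous (fun u : 'rV[R]_p => phi u 0 i : R).
  move=> u; apply/(@cvgrPdist_lt _ _ _ _ (nbhs_filter u)) => e e0.
  have : {for u, continuous (fun v : 'rV[R]_p => sqnorm (v - u) : R)}.
    exact: sqnorm_continuous.
  rewrite /continuous_at => /(@cvgrPdist_lt _ _ _ _ (nbhs_filter u)).
  rewrite subrr => /(_ _ (exprn_gt0 2 e0)).
  apply: filterS => v; rewrite /sqnorm {1}/dot big1 ?sub0r => [|j _]; last first.
    by rewrite mxE mul0r.
  rewrite normrN ger0_norm ?sqnorm_ge0// => h.
  rewrite -(ltr_pXn2r (ltn0Sn 1)) ?nnegrE ?(ltW e0)//.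
  apply: le_lt_trans h; rewrite real_normK ?num_real//.
  apply: le_trans (hphi v u); rewrite -sqnormN opprB.
  by have := sqr_coord_le_sqnorm (phi u - phi v) i; rewrite !mxE.
apply: (measurability _ (RGenOInfty.measurableE R)) => //.
move=> _ [_ [x ->] <-]; rewrite setTI.
rewrite (_ : _ @^-1` _ = X @^-1` [set u | x < phi u 0 i]); last first.
  by apply/seteqP; split => w /=; rewrite in_itv/= andbT.
apply: coord_measurable_open => //.
apply: (@open_comp _ _ (fun u : 'rV[R]_p => phi u 0 i : R) [set r | x < r]).
  by move=> u _; exact: cphi.
exact: open_gt.
Qed.

End RowVectorMeasurability.

Section BorelWrt.
Context d (T : measurableType d) (R : realType) (p : nat) (G : set (set T)).
Hypothesis sG : sigma_algebra setT G.
Local Notation TG := (g_sigma_algebraType G).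

Let measurable_super (A : set T) : G A -> measurable (A : set TG).
Proof. by move=> GA; rewrite measurable_g_measurableTypeE. Qed.

Lemma borel_wrt_measurable (Y : T -> R) : borel_wrt G Y ->
  measurable_fun [set: TG] Y.
Proof.
move=> bY; apply: (measurability _ (RGenOInfty.measurableE R)) => //.
move=> _ [_ [x ->] <-]; rewrite setTI; apply: measurable_super; apply: bY.
by apply: sub_sigma_algebra; exact: interval_open.
Qed.

Lemma borel_wrt_coord_measurable (X : T -> 'rV[R]_p) : borel_wrt G X ->
  coord_measurable (X : TG -> 'rV[R]_p).
Proof.
move=> bX i; apply: (measurability _ (RGenOInfty.measurableE R)) => //.
move=> _ [_ [x ->] <-]; rewrite setTI; apply: measurable_super.
rewrite (_ : _ @^-1` _ = X @^-1` [set u : 'rV[R]_p | x < u 0 i]); last first.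
  by apply/seteqP; split => w /=; rewrite in_itv/= andbT.
apply: bX; apply: sub_sigma_algebra.
apply: (@open_comp _ _ (fun u : 'rV[R]_p => u 0 i : R) [set r | x < r]).
  by move=> u _; exact: coord_continuous.
exact: open_gt.
Qed.

End BorelWrt.

Section SquareIntegrable.
Context d (T : measurableType d) (R : realType) (P : probability T R) (p : nat).
Implicit Types X Y : T -> 'rV[R]_p.

Definition square_integrable X :=
  coord_measurable X /\ P.-integrable setT (fun w => (sqnorm (X w))%:E).

Lemma square_integrable_fin X : coord_measurable X ->
  (\int[P]_w (sqnorm (X w))%:E < +oo)%E -> square_integrable X.
Proof.
move=> mX X2; split => //; apply/integrableP; split.
  by apply/measurable_EFinP; exact: measurable_dot.
by under eq_integral do rewrite /= ger0_norm ?sqnorm_ge0//.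
Qed.

Lemma square_integrable_le X (h : T -> R) : coord_measurable X ->
  P.-integrable setT (EFin \o h) -> (forall w, sqnorm (X w) <= h w) ->
  square_integrable X.
Proof.
move=> mX ih Xh; split=> //; apply: (le_integrable measurableT _ _ ih).
  by apply/measurable_EFinP; exact: measurable_dot.
move=> w _ /=; rewrite lee_fin ger0_norm ?sqnorm_ge0//.
by rewrite (le_trans (Xh w))// ler_norm.
Qed.

Lemma square_integrable_cst (a : 'rV[R]_p) : square_integrable (fun=> a).
Proof.
split; first exact: coord_measurable_cst.
exact: finite_measure_integrable_cst.
Qed.

Lemma square_integrableD X Y : square_integrable X -> square_integrable Y ->
  square_integrable (fun w => X w + Y w).
Proof.
move=> [mX iX] [mY iY].
apply: (@square_integrable_le _ (fun w => 2 * sqnorm (X w) + 2 * sqnorm (Y w))).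
- exact: coord_measurableD.
- rewrite (_ : _ \o _ = (fun w => 2%:E * (sqnorm (X w))%:E) \+
    (fun w => 2%:E * (sqnorm (Y w))%:E))%E; last by apply/funext.
  by apply: integrableD => //; exact: integrableZl.
- by move=> w; exact: sqnormD_le.
Qed.

Lemma square_integrableZ c X : square_integrable X ->
  square_integrable (fun w => c *: X w).
Proof.
move=> [mX iX]; split; first exact: coord_measurableZ.
rewrite (_ : (fun _ => _) = (fun w => (c ^+ 2)%:E * (sqnorm (X w))%:E)%E).
  exact: integrableZl.
by apply/funext => w; rewrite sqnormZ EFinM.
Qed.

Lemma square_integrableB X Y : square_integrable X -> square_integrable Y ->
  square_integrable (fun w => X w - Y w).
Proof.
move=> iX iY; under eq_fun do rewrite -scaleN1r.
by apply: square_integrableD => //; exact: square_integrableZ.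
Qed.

(** Here [c] is the square of a Lipschitz constant, and the value at 0 anchors the growth bound. *)
Lemma square_integrable_lipschitz (phi : 'rV[R]_p -> 'rV[R]_p) c X :
  (forall u v, sqnorm (phi u - phi v) <= c * sqnorm (u - v)) ->
  coord_measurable (fun w => phi (X w)) -> square_integrable X ->
  square_integrable (fun w => phi (X w)).
Proof.
move=> hphi mphi [mX iX].
have [_ i0] := square_integrable_cst (phi 0).
apply: (@square_integrable_le _
  (fun w => 2 * c * sqnorm (X w) + 2 * sqnorm (phi 0))) => //.
- rewrite (_ : _ \o _ = (fun w => (2 * c)%:E * (sqnorm (X w))%:E) \+
    (fun w => 2%:E * (sqnorm (phi 0))%:E))%E; last by apply/funext.
  by apply: integrableD => //; exact: integrableZl.
- move=> w; rewrite -[phi (X w)](subrK (phi 0)).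
  apply: le_trans (sqnormD_le _ _) _; rewrite lerD2r -mulrA ler_pM2l//.
  by have := hphi (X w) 0; rewrite subr0.
Qed.

Lemma integrable_coordM X Y i : square_integrable X -> square_integrable Y ->
  P.-integrable setT (fun w => (X w 0 i * Y w 0 i)%:E).
Proof.
move=> [mX iX] [mY iY].
apply: (le_integrable measurableT _ _ (integrableD measurableT iX iY)).
  by apply/measurable_EFinP; exact: measurable_funM.
move=> w _; rewrite -EFinD /= lee_fin [leRHS]ger0_norm ?addr_ge0 ?sqnorm_ge0//.
have := sqr_coord_le_sqnorm (X w) i; have := sqr_coord_le_sqnorm (Y w) i.
rewrite ler_norml; nra.
Qed.

Lemma integrable_dot X Y : square_integrable X -> square_integrable Y ->
  P.-integrable setT (fun w => (dot (X w) (Y w))%:E).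
Proof.
move=> sX sY; under eq_fun do rewrite -sumEFin.
by apply: integrable_sum => // i _; exact: integrable_coordM.
Qed.

Lemma integral_dot_centered (G : set (set T)) X Y :
  sigma_algebra setT G -> G `<=` measurable ->
  (forall i, P.-integrable setT (fun w => (X w 0 i)%:E)) ->
  (forall i A, G A -> (\int[P]_(w in A) (X w 0 i)%:E = 0)%E) ->
  coord_measurable (Y : g_sigma_algebraType G -> 'rV[R]_p) ->
  square_integrable X -> square_integrable Y ->
  (\int[P]_w (dot (X w) (Y w))%:E = 0)%E.
Proof.
move=> sG GT iX X0 mY sX sY; under eq_integral do rewrite -sumEFin.
rewrite integral_sum//; last by move=> i; exact: integrable_coordM.
rewrite big1// => i _.
apply: (@integral_centered _ _ _ _ _ sG GT (fun w => X w 0 i)) => //.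
- exact: iX.
- exact: X0.
- exact: integrable_coordM.
Qed.

End SquareIntegrable.

(** * Products of the factors 1 - delta *)

Section Decay.
Context {R : realType} (delta : nat -> R).

Lemma decay_refl t : decay delta t t = 1.
Proof. by rewrite /decay big_geq. Qed.

Lemma decay_recr t k : (t <= k)%N ->
  decay delta t k.+1 = decay delta t k * (1 - delta k.+1).
Proof. by move=> tk; rewrite /decay big_nat_recr. Qed.

Lemma decay_recl t k : (t < k)%N ->
  decay delta t k = (1 - delta t.+1) * decay delta t.+1 k.
Proof. by move=> tk; rewrite /decay big_ltn. Qed.

Hypothesis delta_le1 : forall k, delta k.+1 <= 1.

Lemma decay_ge0 t k : 0 <= decay delta t k.
Proof.
rewrite /decay big_nat; apply: prodr_ge0 => -[//|i] _.
by rewrite subr_ge0.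
Qed.

(** [C] is extended-valued because F(xhat_0) may be +oo; the errors are real, which keeps the sums
    well defined. *)
Lemma decay_unroll (C : nat -> \bar R) (r : nat -> R) k :
  (0 <= C 0%N)%E ->
  (forall k, (C k.+1 <= (1 - delta k.+1)%:E * C k + (r k.+1)%:E)%E) ->
  (C k <= (decay delta 0 k)%:E * C 0%N +
    (\sum_(1 <= t < k.+1) decay delta t k * r t)%:E)%E.
Proof.
move=> C0 hC; elim: k => [|k IH].
  by rewrite decay_refl mul1e big_geq// adde0.
apply: le_trans (hC k) _.
rewrite big_nat_recr//= decay_refl mul1r [in leRHS]EFinD addeA.
apply: leeD2r.
apply: le_trans (lee_wpmul2l _ IH) _; first by rewrite lee_fin subr_ge0.
rewrite muleDr ?fin_num_adde_defl// muleA -!EFinM decay_recr// [_ * (1 - _)]mulrC.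
rewrite leeD2l// lee_fin mulr_sumr le_eqVlt; apply/orP; left; apply/eqP.
by apply: eq_big_nat => t /andP[_ tk]; rewrite decay_recr// mulrA [_ * (1 - _)]mulrC.
Qed.

End Decay.

Lemma adapted_mono (T : pointedType) (R : realType) p (G H : set (set T))
    (X : T -> 'rV[R]_p) :
  sigma_algebra setT G -> sigma_algebra setT H -> G `<=` H ->
  coord_measurable (X : g_sigma_algebraType G -> 'rV[R]_p) ->
  coord_measurable (X : g_sigma_algebraType H -> 'rV[R]_p).
Proof.
move=> sG sH GH mX i _ B mB; rewrite measurable_g_measurableTypeE//.
by apply: GH; have := mX i measurableT B mB; rewrite measurable_g_measurableTypeE.
Qed.

(** * Expectation of the descent inequality *)

Section StochasticDescent.
Context (R : realType) (p : nat) (d : measure_display) (T : measurableType d).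
Variables (P : probability T R) (f : 'rV[R]_p -> R) (L : R).
Variables (eta delta alpha : nat -> R) (Fil : nat -> set (set T)).
Variables (g x u : nat -> T -> 'rV[R]_p) (phi : nat -> 'rV[R]_p -> 'rV[R]_p).
Variables (u0 y : 'rV[R]_p).
Hypotheses (L0 : 0 < L) (fL : smooth L f).
Hypothesis hFil : filtration Fil.
Hypothesis hg : unbiased_oracle P Fil f g x.
Hypothesis eta_gt0 : forall k, 0 < eta k.+1.
Hypothesis delta_gt0 : forall k, 0 < delta k.+1.
Hypothesis delta_le1 : forall k, delta k.+1 <= 1.
Hypothesis phi_nonexpansive : forall k a b,
  sqnorm (phi k a - phi k b) <= sqnorm (a - b).
Hypothesis u_0 : forall w, u 0%N w = u0.
Hypothesis x_phi : forall k w, x k w = phi k (u k w).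

(** The next state with the exact gradient in place of the estimate. The point w_t of the overview
    is [phi t] of the center of index t - 1. *)
Definition gradient_center k w : 'rV[R]_p :=
  (1 - alpha k.+1) *: u k w + alpha k.+1 *: x k w - eta k.+1 *: gradient f (x k w).

Definition oracle_noise t w : 'rV[R]_p := g t w - gradient f (x t.-1 w).

Hypothesis u_S : forall k w,
  u k.+1 w = gradient_center k w - eta k.+1 *: oracle_noise k.+1 w.
Hypothesis reset : forall k, delta k.+1 = 1 -> alpha k.+1 = 1 /\
  forall a b, a - eta k.+1 *: gradient f a = b - eta k.+1 *: gradient f b.

Local Notation sqint := (square_integrable P).
Local Notation TF k := (g_sigma_algebraType (Fil k)).
Local Notation v := gradient_center.
Local Notation n := oracle_noise.

Let sF k : sigma_algebra setT (Fil k). Proof. by case: hFil. Qed.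
Let FT k : Fil k `<=` measurable. Proof. by case: hFil. Qed.
Let FS k : Fil k `<=` Fil k.+1. Proof. by case: hFil. Qed.

(** Adaptedness of the gradient is part of its being a version of the conditional expectation. *)
Let grad_adapted k :
  coord_measurable ((fun w => gradient f (x k w)) : TF k -> 'rV[R]_p).
Proof.
move=> i; apply: borel_wrt_measurable => //.
by have [_ /(_ i)[]] := hg k.
Qed.

Lemma iterates_adapted k :
  coord_measurable (u k : TF k -> 'rV[R]_p) /\
  coord_measurable (x k : TF k -> 'rV[R]_p).
Proof.
have xu j : coord_measurable (u j : TF j -> 'rV[R]_p) ->
    coord_measurable (x j : TF j -> 'rV[R]_p).
  move=> mu; rewrite (_ : x j = fun w => phi j (u j w)); last exact/funext.
  exact: coord_measurable_comp.
suff mu : coord_measurable (u k : TF k -> 'rV[R]_p) by split=> //; exact: xu.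
elim: k => [|k IH].
  rewrite (_ : u 0%N = fun=> u0); last exact/funext.
  exact: coord_measurable_cst.
have mg : coord_measurable (g k.+1 : TF k.+1 -> 'rV[R]_p).
  by apply: borel_wrt_coord_measurable => //; case: (hg k).
have up X : coord_measurable (X : TF k -> 'rV[R]_p) ->
    coord_measurable (X : TF k.+1 -> 'rV[R]_p).
  by apply: adapted_mono => //; exact: FS.
rewrite (_ : u k.+1 = fun w => v k w - eta k.+1 *: n k.+1 w); last exact/funext.
have mgr := up _ (grad_adapted (k := k)).
have mxk := up _ (xu _ IH); have muk := up _ IH.
apply: coord_measurableB.
  apply: coord_measurableB; last exact: coord_measurableZ.
  by apply: coord_measurableD; exact: coord_measurableZ.
by apply: coord_measurableZ; exact: coord_measurableB.
Qed.

Lemma center_adapted k : coord_measurable (v k : TF k -> 'rV[R]_p).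
Proof.
have [mu mx] := iterates_adapted k.
apply: coord_measurableB; last exact: coord_measurableZ.
by apply: coord_measurableD; exact: coord_measurableZ.
Qed.

Let adapted_measurable k (X : T -> 'rV[R]_p) :
  coord_measurable (X : TF k -> 'rV[R]_p) -> coord_measurable X.
Proof. by move=> mX i; exact: (measurable_fun_sub (sF k) (@FT k) (mX i)). Qed.

Lemma noise_measurable k : coord_measurable (n k.+1).
Proof.
apply: coord_measurableB.
  apply: (@adapted_measurable k.+1).
  by apply: borel_wrt_coord_measurable => //; case: (hg k).
exact: (@adapted_measurable k).
Qed.

Let noiseE k w i : n k.+1 w 0 i = g k.+1 w 0 i - gradient f (x k w) 0 i.
Proof. by rewrite /oracle_noise mxE [X in _ + X = _]mxE. Qed.

Lemma noise_integrable k i : P.-integrable setT (fun w => (n k.+1 w 0 i)%:E).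
Proof.
have [_ /(_ i)[ig igr _ _]] := hg k.
rewrite (_ : (fun _ => _) = ((EFin \o (fun w => g k.+1 w 0%R i)) \-
  (EFin \o (fun w => gradient f (x k w) 0%R i)))%E); first exact: integrableB.
by apply/funext => w; rewrite noiseE EFinB.
Qed.

Lemma noise_centered k i A : Fil k A ->
  (\int[P]_(w in A) (n k.+1 w 0 i)%:E = 0)%E.
Proof.
move=> FA; have mA := FT FA; have [_ /(_ i)[ig igr _ /(_ A FA) E]] := hg k.
have iA h : P.-integrable setT h -> P.-integrable A h.
  by apply: integrableS.
rewrite (eq_integral (((EFin \o (fun w => g k.+1 w 0%R i)) \-
  (EFin \o (fun w => gradient f (x k w) 0%R i)))%E)); last first.
  by move=> w _; rewrite noiseE EFinB.
rewrite integralB//; [|exact: iA|exact: iA].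
rewrite /= E subee//; apply: integral_fune_fin_num => //; exact: iA.
Qed.

(* When delta = 1 the step forgets the past, and the center is a constant: nothing
   is required of u k, whose second moment may then be infinite. *)
Lemma center_square_integrable k : (delta k.+1 != 1 -> sqint (u k)) -> sqint (v k).
Proof.
have [d1 _|d1 /(_ isT) su] := eqVneq (delta k.+1) 1.
  have [a1 cst] := reset d1.
  rewrite (_ : v k = fun=> 0 - eta k.+1 *: gradient f 0).
    exact: square_integrable_cst.
  by apply/funext => w; rewrite /v a1 subrr scale0r add0r scale1r; exact: cst.
have mx := adapted_measurable (iterates_adapted k).2.
have sx : sqint (x k).
  rewrite (_ : x k = fun w => phi k (u k w)) in mx *; last exact/funext.
  apply: (@square_integrable_lipschitz _ _ _ _ _ (phi k) 1) => // a b.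
  by rewrite mul1r.
apply: square_integrableB.
  by apply: square_integrableD; exact: square_integrableZ.
apply: square_integrableZ.
apply: (square_integrable_lipschitz (smooth_sqnorm L0 fL)) => //.
exact: (@adapted_measurable k).
Qed.

Lemma noise_square_integrable k : (noise_var P f g x k.+1 < +oo)%E -> sqint (n k.+1).
Proof. by move=> ?; apply: square_integrable_fin => //; exact: noise_measurable. Qed.

(* The noises with a zero coefficient in the bound may have infinite variance; they
   are those that precede a step with delta = 1. *)
Lemma state_square_integrable k :
  (forall t, (t < k)%N -> decay delta t.+1 k != 0 ->
     (noise_var P f g x t.+1 < +oo)%E) ->
  forall t, (t <= k)%N -> decay delta t k != 0 -> sqint (u t).
Proof.
move=> hN; elim=> [_ _|t IH tk dt].
  by rewrite (_ : u 0%N = fun=> u0); [exact: square_integrable_cst|exact/funext].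
rewrite (_ : u t.+1 = fun w => v t w - eta t.+1 *: n t.+1 w); last exact/funext.
apply: square_integrableB.
  apply: center_square_integrable => d1; apply: IH; first exact: ltnW.
  by rewrite decay_recl// mulf_neq0// subr_eq0 eq_sym.
by apply: square_integrableZ; apply: noise_square_integrable; exact: hN.
Qed.

Definition descent_error t w : R :=
  delta t * eta t * sqnorm (n t w) + delta t * dot (n t w) (y - phi t (v t.-1 w)).

(** The vector multiplying the noise is adapted to [Fil t], hence orthogonal to it, and only the
    variance survives. *)
Lemma expected_error t : sqint (n t.+1) -> sqint (v t) ->
  P.-integrable setT (fun w => (descent_error t.+1 w)%:E) /\
  (\int[P]_w (descent_error t.+1 w)%:E =
    (delta t.+1 * eta t.+1)%:E * noise_var P f g x t.+1)%E.
Proof.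
move=> sn sv.
have mphi : coord_measurable ((fun w => phi t.+1 (v t w)) : TF t -> 'rV[R]_p).
  by apply: coord_measurable_comp => //; exact: center_adapted.
have sZ : sqint (fun w => y - phi t.+1 (v t w)).
  apply: square_integrableB; first exact: square_integrable_cst.
  apply: (@square_integrable_lipschitz _ _ _ _ _ (phi t.+1) 1) => //.
    by move=> a b; rewrite mul1r.
  exact: (@adapted_measurable t).
have i1 : P.-integrable setT
    (fun w => (delta t.+1 * eta t.+1)%:E * (sqnorm (n t.+1 w))%:E)%E.
  by apply: integrableZl => //; exact: sn.2.
have i2' := integrable_dot sn sZ.
have i2 : P.-integrable setT (fun w => (delta t.+1)%:E *
    (dot (n t.+1 w) (y - phi t.+1 (v t w)))%:E)%E by exact: integrableZl.
have E : (fun w => (descent_error t.+1 w)%:E) =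
  ((fun w => (delta t.+1 * eta t.+1)%:E * (sqnorm (n t.+1 w))%:E) \+
   (fun w => (delta t.+1)%:E * (dot (n t.+1 w) (y - phi t.+1 (v t w)))%:E))%E.
  by apply/funext => w; rewrite /= -!EFinM -EFinD.
split; first by rewrite E; exact: integrableD.
have c0 : (\int[P]_w (dot (n t.+1 w) (y - phi t.+1 (v t w)))%:E = 0)%E.
  apply: (@integral_dot_centered _ _ _ _ _ (Fil t)) => //.
  - exact: noise_integrable.
  - by move=> i A; exact: noise_centered.
  - by apply: coord_measurableB => //; exact: coord_measurable_cst.
rewrite E integralD// (integralZl measurableT i2') c0 mule0 adde0.
by rewrite integralZl//; exact: sn.2.
Qed.

Lemma noise_var_ge0 t : (0 <= noise_var P f g x t)%E.
Proof. by apply: integral_ge0 => w _; rewrite lee_fin sqnorm_ge0. Qed.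

Theorem expected_descent (C : nat -> T -> \bar R) (C0 : \bar R) :
  (forall w, C 0%N w = C0) -> (0 <= C0)%E ->
  (forall k w, C k.+1 w <=
     (1 - delta k.+1)%:E * C k w + (descent_error k.+1 w)%:E)%E ->
  forall k, (\int[P]_w C k w <= (decay delta 0 k)%:E * C0 +
    \sum_(1 <= t < k.+1)
       (decay delta t k * (delta t * eta t))%:E * noise_var P f g x t)%E.
Proof.
move=> hC0 C00 hC k; set N := (\sum_(1 <= t < k.+1) _)%E.
have coef0 t : (0 < t)%N -> 0 <= decay delta t k * (delta t * eta t).
  case: t => // t _; rewrite mulr_ge0 ?decay_ge0// mulr_ge0// ltW//.
have term0 t : (0 < t)%N ->
    (0 <= (decay delta t k * (delta t * eta t))%:E * noise_var P f g x t)%E.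
  by move=> t0; rewrite mule_ge0 ?noise_var_ge0// lee_fin coef0.
have K00 : (0 <= (decay delta 0 k)%:E * C0)%E.
  by rewrite mule_ge0// lee_fin decay_ge0.
have N0 : (0 <= N)%E.
  by rewrite /N big_nat; apply: sume_ge0 => t /andP[t0 _]; exact: term0.
have [Kfin|] := boolP ((decay delta 0 k)%:E * C0 \is a fin_num)%E; last first.
  rewrite ge0_fin_numE// -leNgt leye_eq => /eqP ->.
  by rewrite addye ?leey// gt_eqF// (lt_le_trans _ N0)// ltNyr.
have [Nfin|] := boolP (N \is a fin_num); last first.
  rewrite ge0_fin_numE// -leNgt leye_eq => /eqP ->.
  by rewrite addey ?leey// gt_eqF// (lt_le_trans _ K00)// ltNyr.
(* An infinite variance with a positive coefficient would make the sum [N] of nonnegative terms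
   infinite. *)
have noise_fin t : (t < k)%N -> decay delta t.+1 k != 0 ->
    (noise_var P f g x t.+1 < +oo)%E.
  move=> tk dt; rewrite ltey; apply: contraTneq Nfin => nt.
  rewrite ge0_fin_numE// -leNgt /N (bigD1_seq t.+1) ?iota_uniq//=; last first.
    by rewrite mem_index_iota.
  rewrite nt gt0_muley ?addye//.
    rewrite gt_eqF// (lt_le_trans (ltNyr 0))// big_seq_cond.
    apply: sume_ge0 => i /andP[]; rewrite mem_index_iota => /andP[i0 _] _.
    exact: term0.
  rewrite lte_fin mulr_gt0 ?mulr_gt0// lt_neqAle eq_sym dt.
  exact: decay_ge0.
have main t : (t < k)%N ->
    P.-integrable setT (fun w => (decay delta t.+1 k * descent_error t.+1 w)%:E) /\
    (\int[P]_w (decay delta t.+1 k * descent_error t.+1 w)%:E =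
     (decay delta t.+1 k * (delta t.+1 * eta t.+1))%:E * noise_var P f g x t.+1)%E.
  (* A zero coefficient removes the error even when its variance is infinite. *)
  move=> tk; have [d0|d0] := eqVneq (decay delta t.+1 k) 0.
    rewrite d0 mul0r mul0e; under eq_fun do rewrite mul0r.
    by rewrite integral0; split => //; exact: integrable0.
  have [|ie Ee] := @expected_error t (noise_square_integrable (noise_fin _ tk d0)).
    apply: center_square_integrable => d1.
    apply: (state_square_integrable noise_fin); first exact: ltnW.
    by rewrite decay_recl// mulf_neq0// subr_eq0 eq_sym.
  under eq_fun do rewrite EFinM.
  split; first exact: integrableZl.
  by rewrite integralZl// Ee [in RHS]EFinM muleA.
(* The majorant is a finite constant plus integrable errors, so its integral splits. The error of
   step t.+1 is stored under the ordinal t. *)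
have CU w : (C k w <= (fine ((decay delta 0 k)%:E * C0))%:E +
    \sum_(t < k) (decay delta t.+1 k * descent_error t.+1 w)%:E)%E.
  rewrite sumEFin -(big_mkord xpredT (fun t => decay delta t.+1 k * descent_error t.+1 w)).
  rewrite -(big_add1 _ _ 0 k.+1 xpredT (fun t => decay delta t k * descent_error t w)).
  rewrite fineK// -(hC0 w).
  apply: (@decay_unroll _ _ delta_le1 (fun k => C k w) (descent_error ^~ w)).
    by rewrite hC0.
  by move=> j; exact: hC.
apply: le_trans (le_integral_nomeas P CU) _.
rewrite integralD//; last 2 first.
- exact: finite_measure_integrable_cst.
- by apply: integrable_sum => // t _; exact: (main t (ltn_ord t)).1.
have -> : (\int[P]__ (fine ((decay delta 0 k)%:E * C0))%:E =
    (decay delta 0 k)%:E * C0)%E.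
  rewrite (_ : (fun _ => _) = cst (fine ((decay delta 0 k)%:E * C0))%:E)//.
  rewrite integral_cst// [X in (_ * X)%E](@probability_setT _ _ _ P).
  by rewrite mule1 fineK.
rewrite leeD2l//.
rewrite integral_sum//; last by move=> t; exact: (main t (ltn_ord t)).1.
rewrite /N big_add1 /= big_mkord le_eqVlt; apply/orP; left; apply/eqP.
by apply: eq_bigr => t _; exact: (main t (ltn_ord t)).2.
Qed.

End StochasticDescent.

(** * Surrogates of the two algorithms *)

Lemma minval_argmin (R : realType) p (h : 'rV[R]_p -> \bar R) z :
  argmin h z -> minval h = h z.
Proof.
move=> hz; apply/le_anti/andP; split; first by apply: ereal_inf_lbound; exists z.
by apply: le_ereal_inf_tmp => _ [y _ <-]; exact: hz.
Qed.

(** Since delta / eta = gamma' = (1 - delta) gamma + mu delta, the chosen subgradient cancels every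
    term linear in y - z: the new surrogate is a parabola centered at z. *)
Lemma prox_surrogate_expansion (R : realType) p (f : 'rV[R]_p -> R)
    (mu eta gamma gamma' delta c : R) (x z g y : 'rV[R]_p) :
  0 < eta -> delta = eta * gamma' ->
  gamma' = (1 - delta) * gamma + mu * delta ->
  (1 - delta) * (c + gamma / 2 * sqnorm (y - x)) +
  delta * (quad_model mu f x g y + dot (eta^-1 *: (x - z) - g) (y - z)) =
  (1 - delta) * c + gamma' / 2 * sqnorm (z - x) +
  delta * (f x + dot g (z - x)) + gamma' / 2 * sqnorm (y - z).
Proof.
move=> eta0 deltaE gammaE.
have -> : x - z = - (z - x) by rewrite opprB.
rewrite /quad_model; have -> : y - x = (y - z) + (z - x) by rewrite addrA subrK.
move: (y - z) (z - x) => e h.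
rewrite (sqnormD e) dotDr dotDl dotZl !dotNl (dotC h).
have E : delta * (eta^-1 * - dot e h) = - gamma' * dot e h.
  by rewrite deltaE; field; rewrite gt_eqF.
have G q : gamma' * q = (1 - delta) * gamma * q + mu * delta * q.
  by rewrite {1}gammaE; ring.
have := G (sqnorm e); have := G (dot e h); have := G (sqnorm h); lra.
Qed.

(** The new dual average is the critical point of the left side, because (1 - delta) gamma = gamma'
    (1 - mu eta); c' is the value there. *)
Lemma dual_surrogate_expansion (R : realType) p (f : 'rV[R]_p -> R)
    (mu eta gamma gamma' delta c : R) (x b g : 'rV[R]_p) :
  delta = eta * gamma' -> gamma' = (1 - delta) * gamma + mu * delta ->
  exists c', forall y,
  (1 - delta) * (c + gamma / 2 * sqnorm (y - b)) + delta * quad_model mu f x g y =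
  c' + gamma' / 2 *
    sqnorm (y - ((1 - mu * eta) *: b + (mu * eta) *: x - eta *: g)).
Proof.
move=> deltaE gammaE.
set b' := (1 - mu * eta) *: b + (mu * eta) *: x - eta *: g.
exists ((1 - delta) * (c + gamma / 2 * sqnorm (b' - b)) +
  delta * quad_model mu f x g b') => y.
rewrite /quad_model.
have -> : y - b = (y - b') + (b' - b) by rewrite addrA subrK.
have -> : y - x = (y - b') + (b' - x) by rewrite addrA subrK.
have E : dot (y - b') ((1 - delta) * gamma *: (b' - b) + delta *: g +
    (delta * mu) *: (b' - x)) = 0.
  have -> : (1 - delta) * gamma = gamma' * (1 - mu * eta).
    by rewrite -[LHS](addrK (mu * delta)) -gammaE deltaE; ring.
  rewrite deltaE -[RHS](mul0r (dot (y - b') 0)) -dotZr; congr dot.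
  by apply/rowP => i; rewrite !mxE; ring.
move: E; move: (y - b') (b' - b) (b' - x) => e h1 h2.
rewrite !dotDr !dotZr (sqnormD e h1) (sqnormD e h2) (dotC g) => E.
have G : gamma' * sqnorm e = (1 - delta) * gamma * sqnorm e + mu * delta * sqnorm e.
  by rewrite {1}gammaE; ring.
lra.
Qed.

Section DescentRun.
Context (R : realType) (p : nat) (d : measure_display) (T : measurableType d).
Variables (f : 'rV[R]_p -> R) (psi : 'rV[R]_p -> \bar R) (L mu : R).
Variables (xstar : 'rV[R]_p) (eta gamma delta : nat -> R).
Variables (g x : nat -> T -> 'rV[R]_p).
Variables (D0 : 'rV[R]_p -> \bar R) (D : nat -> T -> 'rV[R]_p -> \bar R).

(* A common form of the two algorithms: u k is the point at which the proximal map
   phi k is evaluated.  Algorithm (A) has alpha = 1 and phi 0 = id; in Algorithm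
   (B), u is the sequence of the dual averages and alpha = mu * eta. *)
Definition descent_run (alpha : nat -> R) (u : nat -> T -> 'rV[R]_p)
    (phi : nat -> 'rV[R]_p -> 'rV[R]_p) : Prop :=
  [/\ (exists u0, forall w, u 0%N w = u0) /\ (forall k w, x k w = phi k (u k w)),
      (forall k a b, sqnorm (phi k a - phi k b) <= sqnorm (a - b)),
      (forall k w, u k.+1 w = gradient_center f eta alpha x u k w
         - eta k.+1 *: oracle_noise f g x k.+1 w),
      (forall k, mu * eta k.+1 = 1 -> alpha k.+1 = 1) &
      (forall w, D 0%N w = D0) /\ forall k w,
      [/\ D k w xstar \is a fin_num, minval (D k w) \is a fin_num,
          psi (x k.+1 w) \is a fin_num,
          fine (D k.+1 w xstar) <= (1 - delta k.+1) * fine (D k w xstar) +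
            delta k.+1 * (quad_model mu f (x k w) (g k.+1 w) xstar + fine (psi xstar)) &
          (1 - delta k.+1) * fine (minval (D k w))
            + gamma k.+1 / 2 * sqnorm (x k.+1 w - x k w)
            + delta k.+1 * (f (x k w) + dot (g k.+1 w) (x k.+1 w - x k w)
                            + fine (psi (x k.+1 w))) <= fine (minval (D k.+1 w))]].

Hypotheses (L0 : 0 < L) (fL : smooth L f).
Hypotheses (psi_proper : proper_efun psi) (psi_convex : econvex psi).
Hypothesis psi_lsc : lower_semicontinuous psi.
Hypothesis xstar_min : argmin (composite f psi) xstar.
Hypothesis par : parameters mu eta gamma delta.
Hypothesis mu_eta : forall k, mu * eta k.+1 <= 1.

Let pstar : psi xstar \is a fin_num. Proof. exact: argmin_fin_num xstar_min. Qed.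

Let pdom : exists y, psi y \is a fin_num. Proof. by exists xstar. Qed.

Let psi_ge y : ((fine (psi xstar) + dot (gradient f xstar) xstar
  + dot (- gradient f xstar) y)%:E <= psi y)%E.
Proof.
have := argmin_subgradient psi_proper psi_convex L0 fL xstar_min y.
by rewrite dotDr !(dotNr, dotNl) opprD opprK addrA addrAC.
Qed.

Let fin s u : 0 < s -> psi (prox s psi u) \is a fin_num.
Proof. exact: (prox_fin_num psi_proper psi_lsc psi_ge pdom). Qed.

Let eta0 k : 0 < eta k.+1. Proof. by case: par. Qed.
Let deltaE k : delta k.+1 = eta k.+1 * gamma k.+1. Proof. by case: par. Qed.
Let gammaE k : gamma k.+1 = (1 - delta k.+1) * gamma k + mu * delta k.+1.
Proof. by case: par. Qed.
Let gamma_gt0 k : 0 < gamma k. Proof. by case: (parameters_gamma par mu_eta k). Qed.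
Let delta_gt0 k : 0 < delta k.+1. Proof. by case: (parameters_delta par mu_eta k). Qed.
Let delta_le1 k : delta k.+1 <= 1. Proof. by case: (parameters_delta par mu_eta k). Qed.

Lemma run_A_descent : run_A mu f psi eta gamma delta g x D0 D ->
  exists alpha u phi, descent_run alpha u phi.
Proof.
move=> [x0 [c0 [x_0 x_S D0E D_0 D_S]]].
exists (fun=> 1).
exists (fun k w => if k is j.+1 then x j w - eta j.+1 *: g j.+1 w else x0).
exists (fun k => if k is j.+1 then prox (eta j.+1) psi else id).
have px k w : psi (x k.+1 w) \is a fin_num by rewrite x_S fin.
have DS k w y r : D k w y = r%:E -> D k.+1 w y = ((1 - delta k.+1) * r +
    delta k.+1 * (quad_model mu f (x k w) (g k.+1 w) y + fine (psi (x k.+1 w)) +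
      dot ((eta k.+1)^-1 *: (x k w - x k.+1 w) - g k.+1 w) (y - x k.+1 w)))%:E.
  by move=> E; rewrite D_S E /= !EFinD !EFinM !EFinD (fineK (px k w)).
have DE k w : exists c, forall y,
    D k w y = (c + gamma k / 2 * sqnorm (y - x k w))%:E.
  elim: k => [|k [c IH]]; first by exists c0 => y; rewrite D_0 D0E x_0.
  exists ((1 - delta k.+1) * c + gamma k.+1 / 2 * sqnorm (x k.+1 w - x k w)
    + delta k.+1 * (f (x k w) + dot (g k.+1 w) (x k.+1 w - x k w))
    + delta k.+1 * fine (psi (x k.+1 w))) => y.
  rewrite (DS _ _ _ _ (IH y)); congr EFin.
  have := prox_surrogate_expansion f c (x k w) (x k.+1 w) (g k.+1 w) y
    (eta0 k) (deltaE k) (gammaE k).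
  lra.
have Dmin k w : minval (D k w) = D k w (x k w).
  apply: minval_argmin => y; have [c E] := DE k w.
  rewrite !E subrr sqnorm0 mulr0 lee_fin lerD2l.
  by rewrite mulr_ge0 ?sqnorm_ge0// divr_ge0// ltW.
split.
- split; first by exists x0.
  by move=> [|k] w; rewrite ?x_0 ?x_S.
- move=> [//|k] a b.
  exact: (prox_nonexpansive psi_proper psi_convex psi_lsc psi_ge pdom).
- move=> k w; rewrite /gradient_center /oracle_noise subrr scale0r add0r scale1r /=.
  by apply/rowP => i; rewrite !mxE; ring.
- by [].
split => // k w; have [c E] := DE k w; have [c' E'] := DE k.+1 w.
rewrite !Dmin !E E'; split => //.
(* The linearization of psi used by the surrogate lies below psi at xstar, as its slope is a
   subgradient by [prox_variational]. *)
- rewrite -E' (DS _ _ _ _ (E xstar)) /= lerD2l ler_pM2l// -addrA lerD2l.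
  have := prox_variational psi_proper psi_convex psi_lsc psi_ge pdom
    (x k w - eta k.+1 *: g k.+1 w) (eta0 k) pstar.
  rewrite -x_S.
  have -> : x k w - eta k.+1 *: g k.+1 w - x k.+1 w =
      eta k.+1 *: ((eta k.+1)^-1 *: (x k w - x k.+1 w) - g k.+1 w).
    by rewrite scalerBr scalerA divff ?gt_eqF// scale1r addrAC.
  by rewrite dotZl -mulrDr ler_pM2l.
- rewrite (DS _ _ _ _ (E (x k.+1 w))) /=.
  have := prox_surrogate_expansion f c (x k w) (x k.+1 w) (g k.+1 w) (x k.+1 w)
    (eta0 k) (deltaE k) (gammaE k).
  rewrite !subrr !sqnorm0; lra.
Qed.

Lemma run_B_descent : run_B mu f psi eta gamma delta g x D0 D ->
  exists alpha u phi, descent_run alpha u phi.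
Proof.
move=> [xbar0 [c0 [xbar [[xbar_0 xbar_S] xE D0E D_0 D_S]]]].
exists (fun k => mu * eta k), xbar, (fun k => prox (gamma k)^-1 psi).
have gi k : 0 < (gamma k)^-1 by rewrite invr_gt0.
have px k w : psi (x k w) \is a fin_num by rewrite xE fin.
have DE k w : exists c, forall y,
    D k w y = ((c + gamma k / 2 * sqnorm (y - xbar k w))%:E + psi y)%E.
  elim: k => [|k [c IH]]; first by exists c0 => y; rewrite D_0 D0E xbar_0.
  have [c' E] := dual_surrogate_expansion f c (x k w) (xbar k w) (g k.+1 w)
    (deltaE k) (gammaE k).
  exists c' => y; rewrite D_S IH xbar_S.
  case: (psi y) (psi_proper.1 y) => [q _|_|/eqP//].
    have H r s t : ((1 - t)%:E * (r%:E + q%:E) + t%:E * (s%:E + q%:E) =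
        ((1 - t) * r + t * s)%:E + q%:E)%E.
      by rewrite -!EFinD; congr EFin; ring.
    by rewrite H E.
  rewrite !addey//.
  (* Where psi is +oo and delta = 1, the old surrogate contributes 0 * +oo = 0, but the new term is
     still +oo. *)
  have := delta_le1 k; rewrite -subr_ge0 le_eqVlt => /predU1P[<-|d1].
    by rewrite mul0e add0e gt0_muley ?lte_fin.
  by rewrite !gt0_muley ?lte_fin.
have DE' k w : exists c, forall y, psi y \is a fin_num ->
    D k w y = (c + gamma k / 2 * sqnorm (y - xbar k w) + fine (psi y))%:E.
  by have [c E] := DE k w; exists c => y py; rewrite E -{1}(fineK py).
have Dge k w y : psi y \is a fin_num ->
    fine (D k w (x k w)) + gamma k / 2 * sqnorm (y - x k w) <= fine (D k w y).
  move=> py; have [c E] := DE' k w; rewrite !E//= -!addrA lerD2l.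
  have := prox_three_point psi_proper psi_convex psi_lsc psi_ge pdom
    (xbar k w) (gi k) py.
  rewrite -xE -(ler_pM2l (gamma_gt0 k)) !mulrDr !mulrA divff ?gt_eqF// !mul1r.
  lra.
have Dmin k w : minval (D k w) = D k w (x k w).
  apply: minval_argmin => y.
  have [py|] := boolP (psi y \is a fin_num); last first.
    rewrite fin_numE psi_proper.1/= negbK => /eqP py; have [c E] := DE k w.
    by rewrite [leRHS]E py addey// leey.
  have := Dge k w _ py; have [c E] := DE' k w; rewrite !E// lee_fin /=.
  by apply: le_trans; rewrite lerDl mulr_ge0 ?sqnorm_ge0// divr_ge0// ltW.
split.
- split; first by exists xbar0.
  exact: xE.
- move=> k a b.
  exact: (prox_nonexpansive psi_proper psi_convex psi_lsc psi_ge pdom).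
- move=> k w; rewrite xbar_S /gradient_center /oracle_noise /=.
  by apply/rowP => i; rewrite !mxE; ring.
- by [].
have DS k w y : psi y \is a fin_num -> fine (D k.+1 w y) =
    (1 - delta k.+1) * fine (D k w y) +
    delta k.+1 * (quad_model mu f (x k w) (g k.+1 w) y + fine (psi y)).
  move=> py; have [c E] := DE' k w.
  by rewrite D_S E//; case: (psi y) py.
split => // k w.
split => //.
- by have [c ->] := DE' k w.
- by rewrite Dmin; have [c ->] := DE' k w.
- by rewrite DS.
- rewrite !Dmin DS//.
  have := delta_le1 k; rewrite -subr_ge0 => d1.
  (* The growth of the old surrogate is used at the next iterate; with the mu-term of the model it
     adds up to gamma_(k+1) / 2. *)
  have := ler_wpM2l d1 (Dge k w _ (px k.+1 w)).
  rewrite /quad_model [gamma k.+1 / 2]mulrC {1}(gammaE k); lra.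
Qed.

End DescentRun.

(** * Bounds for the last and the averaged iterate *)

Section Conclusion.
Context (R : realType) (p : nat) (d : measure_display) (T : measurableType d).
Variables (P : probability T R).
Variables (f : 'rV[R]_p -> R) (psi : 'rV[R]_p -> \bar R) (L mu : R).
Variables (xstar : 'rV[R]_p) (eta gamma delta : nat -> R) (Fil : nat -> set (set T)).
Variables (g x : nat -> T -> 'rV[R]_p).
Variables (D0 : 'rV[R]_p -> \bar R) (D : nat -> T -> 'rV[R]_p -> \bar R).
Hypotheses (L0 : 0 < L) (fL : smooth L f) (mu0 : 0 <= mu).
Hypothesis fmu : strongly_convex mu f.
Hypotheses (psi_proper : proper_efun psi) (psi_convex : econvex psi).
Hypothesis xstar_min : argmin (composite f psi) xstar.
Hypothesis par : parameters mu eta gamma delta.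
Hypothesis eta_le : forall k, eta k.+1 <= 1 / L.
Hypotheses (hFil : filtration Fil) (hg : unbiased_oracle P Fil f g x).
Hypothesis mu_eta : forall k, mu * eta k.+1 <= 1.
Variables (alpha : nat -> R) (u : nat -> T -> 'rV[R]_p).
Variable phi : nat -> 'rV[R]_p -> 'rV[R]_p.
Hypothesis run : descent_run f psi mu xstar eta gamma delta g x D0 D alpha u phi.

Local Notation F := (composite f psi).

Let pstar : psi xstar \is a fin_num.
Proof. exact: argmin_fin_num xstar_min. Qed.

Let Fstar := f xstar + fine (psi xstar).

Let FstarE : F xstar = Fstar%:E. Proof. by rewrite /composite EFinD fineK. Qed.

Let gap k w := fine (D k w xstar) - fine (minval (D k w)).

Let error := descent_error f eta delta alpha g x u phi xstar.

Let etaL k : eta k.+1 * L <= 1. Proof. by rewrite -ler_pdivlMr. Qed.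

Let eta0 k : 0 < eta k.+1. Proof. by case: par. Qed.
Let delta_gt0 k : 0 < delta k.+1. Proof. by case: (parameters_delta par mu_eta k). Qed.
Let delta_le1 k : delta k.+1 <= 1. Proof. by case: (parameters_delta par mu_eta k). Qed.

Let gapE k w : (D k w xstar - minval (D k w) = (gap k w)%:E)%E.
Proof.
have [_ _ _ _ [_ /(_ k w)[Df mf _ _ _]]] := run.
by rewrite EFinB !fineK.
Qed.

Let gap_ge0 k w : 0 <= gap k w.
Proof.
have [_ _ _ _ [_ /(_ k w)[Df mf _ _ _]]] := run.
by rewrite subr_ge0 fine_le//; apply: ereal_inf_lbound; exists xstar.
Qed.

Let addr_gap k w (e : \bar R) :
  (e + D k w xstar - minval (D k w) = e + (gap k w)%:E)%E.
Proof.
have [_ _ _ _ [_ /(_ k w)[Df mf _ _ _]]] := run.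
by rewrite -gapE -(fineK Df) -(fineK mf) addeA.
Qed.

Let psi_x k w : psi (x k.+1 w) \is a fin_num.
Proof. by have [_ _ _ _ [_ /(_ k w)[]]] := run. Qed.

(** Index k refers to x_(k+1): in Algorithm (A), psi may be +oo at the initial point. *)
Let subopt k w := f (x k.+1 w) + fine (psi (x k.+1 w)) - Fstar.

Let suboptE k w : (F (x k.+1 w) - F xstar = (subopt k w)%:E)%E.
Proof. by rewrite FstarE /composite -{1}(fineK (psi_x k w)). Qed.

Let step k w : delta k.+1 * subopt k w + gap k.+1 w <=
  (1 - delta k.+1) * gap k w + error k.+1 w.
Proof.
have [[_ xE] nexp u_S _ [_ /(_ k w)[_ _ _ h1 h2]]] := run.
have [_ _ _ deltaE _] := par.
apply: (surrogate_step L0 fL fmu (delta_gt0 k) (eta0 k) (etaL k) _ (deltaE k) h1 h2).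
  by case: (parameters_gamma par mu_eta k.+1).
rewrite xE; apply: le_trans (nexp _ _ _) _.
by rewrite u_S opprB [X in sqnorm X]addrC subrK sqnormZ.
Qed.

Let reset k : delta k.+1 = 1 -> alpha k.+1 = 1 /\
  forall a b, a - eta k.+1 *: gradient f a = b - eta k.+1 *: gradient f b.
Proof.
have [_ _ _ al _] := run.
move=> d1; have [_ _ /(_ d1) me] := parameters_delta par mu_eta k.
by split; [exact: al|exact: (gradient_step_constant L0 fL fmu (eta0 k) (etaL k) me)].
Qed.

Let bound (C : nat -> T -> \bar R) (C0 : \bar R) :
  (forall w, C 0%N w = C0) -> (0 <= C0)%E ->
  (forall k w, C k.+1 w <= (1 - delta k.+1)%:E * C k w + (error k.+1 w)%:E)%E ->
  forall k, (\int[P]_w C k w <= (decay delta 0 k)%:E * C0 +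
    \sum_(1 <= t < k.+1)
       (decay delta t k * (delta t * eta t))%:E * noise_var P f g x t)%E.
Proof.
have [[[u0 uE] xE] nexp u_S _ _] := run.
exact: (expected_descent L0 fL hFil hg eta0 delta_gt0 delta_le1 nexp uE xE u_S reset).
Qed.

(** [step] involves only the old gap on the right; adding the nonnegative delta_k (F(x_k) -
    F(xstar)) there closes the recursion for [C], which starts without a suboptimality term. *)
Lemma last_iterate_bound k : (1 <= k)%N ->
  (\int[P]_w ((delta k)%:E * (F (x k w) - F xstar) + D k w xstar - minval (D k w))
   <= (decay delta 0 k)%:E * (D0 xstar - minval D0) +
    \sum_(1 <= t < k.+1)
       (decay delta t k * (delta t * eta t))%:E * noise_var P f g x t)%E.
Proof.
have [_ _ _ _ [D_0 _]] := run.
pose C k w := if k is j.+1 then ((delta k * subopt j w + gap k w)%:E) else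
  (D0 xstar - minval D0)%E.
case: k => // k _; rewrite (eq_integral (C k.+1)) => [|w _]; last first.
  by rewrite addr_gap suboptE.
have C0E w : (D0 xstar - minval D0 = (gap 0 w)%:E)%E by rewrite -gapE D_0.
apply: bound => //.
- by rewrite (C0E point) lee_fin gap_ge0.
- move=> j w; have -> : (C j w = (if j is i.+1 then delta j * subopt i w else 0)%:E
      + (gap j w)%:E)%E.
    by case: j => [|j]; rewrite /C -?EFinD// add0r (C0E w).
  rewrite /C -!EFinD lee_fin; apply: le_trans (step j w) _.
  rewrite lerD2r ler_wpM2l ?subr_ge0// lerDr.
  case: j => // j; rewrite mulr_ge0 ?(ltW (delta_gt0 _))//.
  by rewrite -lee_fin -suboptE FstarE sube_ge0// -FstarE; exact: xstar_min.
Qed.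

(** Convexity of F along the averaging produces exactly the term delta (F(x) - F(xstar)) that [step]
    controls. *)
Lemma averaged_iterate_bound (xhat0 : 'rV[R]_p) (xhat : nat -> T -> 'rV[R]_p) k :
  averaging delta x xhat0 xhat ->
  (\int[P]_w (F (xhat k w) - F xstar + D k w xstar - minval (D k w))
   <= (decay delta 0 k)%:E * (F xhat0 - F xstar + D0 xstar - minval D0) +
    \sum_(1 <= t < k.+1)
       (decay delta t k * (delta t * eta t))%:E * noise_var P f g x t)%E.
Proof.
move=> [xhat_0 xhat_S]; have [_ _ _ _ [D_0 _]] := run.
have Fge0 z : (0 <= F z - F xstar)%E.
  by rewrite FstarE sube_ge0// -FstarE; exact: xstar_min.
apply: (@bound (fun k w =>
  F (xhat k w) - F xstar + D k w xstar - minval (D k w))%E).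
- by move=> w; rewrite xhat_0 D_0.
- by rewrite -(D_0 point) addr_gap adde_ge0// lee_fin gap_ge0.
move=> {}k w; rewrite !addr_gap.
have avg : (F (xhat k.+1 w) - F xstar <=
    (1 - delta k.+1)%:E * (F (xhat k w) - F xstar) + (delta k.+1 * subopt k w)%:E)%E.
  have d1 : 0 <= 1 - delta k.+1 by rewrite subr_ge0.
  have [ph|] := boolP (psi (xhat k w) \is a fin_num); last first.
    rewrite fin_numE psi_proper.1/= negbK => /eqP ph.
    (* An average with infinite value is either forgotten, when delta = 1, or makes the right side
       +oo. *)
    move: d1; rewrite le_eqVlt => /predU1P[d1|d1].
      have -> : xhat k.+1 w = x k.+1 w.
        by rewrite xhat_S -d1 scale0r add0r -[delta _](subKr 1) -d1 subr0 scale1r.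
      rewrite -d1 mul0e add0e suboptE lee_fin.
      by rewrite -[delta _](subKr 1) -d1 subr0 mul1r.
    by rewrite FstarE /composite ph addey// addye// gt0_muley// addye// leey.
  have xhatE : xhat k.+1 w = xhat k w + delta k.+1 *: (x k.+1 w - xhat k w).
    by rewrite xhat_S; apply/rowP => i; rewrite !mxE; ring.
  have [ph' hpsi] := econvex_fin psi_proper psi_convex ph (psi_x k w)
    (ltW (delta_gt0 k)) (delta_le1 k).
  have := fmu (x k.+1 w) (xhat k w) (ltW (delta_gt0 k)) (delta_le1 k).
  rewrite -xhatE in ph' hpsi.
  rewrite [_ *: _ + _]addrC -xhat_S => hf.
  have q0 : 0 <= mu / 2 * delta k.+1 * (1 - delta k.+1) * sqnorm (x k.+1 w - xhat k w).
    by rewrite mulr_ge0 ?sqnorm_ge0// mulr_ge0// mulr_ge0 ?(ltW (delta_gt0 _))// divr_ge0.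
  rewrite FstarE /composite -(fineK ph) -(fineK ph') -!EFinD lee_fin /=.
  rewrite /subopt; lra.
apply: le_trans (leeD2r _ avg) _.
move: (F (xhat k w) - F xstar)%E => e.
rewrite muleDr ?fin_num_adde_defl//.
rewrite -!addeA leeD2l// -EFinM -!EFinD lee_fin.
exact: step.
Qed.

End Conclusion.

Theorem theorem2 (R : realType) (p : nat) (d : measure_display)
    (T : measurableType d) (P : probability T R)
    (f : 'rV[R]_p -> R) (psi : 'rV[R]_p -> \bar R) (L mu : R)
    (xstar : 'rV[R]_p)
    (eta gamma delta : nat -> R) (Fil : nat -> set (set T))
    (g x : nat -> T -> 'rV[R]_p)
    (D0 : 'rV[R]_p -> \bar R) (D : nat -> T -> 'rV[R]_p -> \bar R)
    (hL : 0 < L) (hfL : smooth L f)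
    (hmu : 0 <= mu) (hfmu : strongly_convex mu f)
    (hpsi_proper : proper_efun psi) (hpsi_convex : econvex psi)
    (hpsi_lsc : lower_semicontinuous psi)
    (hxstar : argmin (composite f psi) xstar)
    (hpar : parameters mu eta gamma delta)
    (heta : forall k : nat, eta k.+1 <= 1 / L)
    (hFil : filtration Fil)
    (hg : unbiased_oracle P Fil f g x)
    (hrun : run_A mu f psi eta gamma delta g x D0 D \/
            run_B mu f psi eta gamma delta g x D0 D) :
  let F := composite f psi in
  let noise := fun k : nat =>
    (\sum_(1 <= t < k.+1)
       (decay delta t k * (delta t * eta t))%:E * noise_var P f g x t)%E in
  (forall k : nat, (1 <= k)%N ->
     (\int[P]_w ((delta k)%:E * (F (x k w) - F xstar)
                 + D k w xstar - minval (D k w))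
      <= (decay delta 0 k)%:E * (D0 xstar - minval D0) + noise k)%E) /\
  (forall (xhat0 : 'rV[R]_p) (xhat : nat -> T -> 'rV[R]_p),
     averaging delta x xhat0 xhat ->
     forall k : nat, (1 <= k)%N ->
     (\int[P]_w (F (xhat k w) - F xstar + D k w xstar - minval (D k w))
      <= (decay delta 0 k)%:E *
           (F xhat0 - F xstar + D0 xstar - minval D0) + noise k)%E).
Proof.
move=> F noise.
have [p0|p0] := posnP p.
  (* In dimension 0 the bound mu <= L may fail, but every gap vanishes. *)
  subst p.
  have E0 (a : 'rV[R]_0) : a = xstar by rewrite [a]thinmx0 [xstar]thinmx0.
  have pstar := argmin_fin_num hpsi_proper hxstar.
  have Ffin : F xstar \is a fin_num by rewrite /F /composite fin_numD.
  have minE (h : 'rV[R]_0 -> \bar R) : minval h = h xstar.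
    by apply: minval_argmin => y; rewrite (E0 y).
  have D0fin : D0 xstar \is a fin_num.
    case: hrun => [[x0 [c0 [_ _ -> _ _]]]//|[xb [c0 [xbar [_ _ -> _ _]]]]].
    by rewrite fin_numD pstar.
  have noise0 k : noise k = 0%E.
    rewrite /noise big1// => t _; rewrite /noise_var.
    under eq_integral do rewrite [sqnorm _]big_ord0.
    by rewrite integral0 mule0.
  (* The convention +oo - +oo = -oo lets this cover infinite values of the surrogates. *)
  have sub_le0 (e : \bar R) : (e - e <= 0)%E.
    by case: e => [r| |]; [rewrite subee|rewrite addeNy leNye|rewrite addNye leNye].
  split=> [k _|xhat0 xhat _ k _]; rewrite noise0 adde0.
    rewrite minE subee// mule0 -(@integral0 _ _ _ P setT).
    apply: le_integral_nomeas => w.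
    by rewrite (E0 (x k w)) subee// mule0 add0e minE; exact: sub_le0.
  rewrite minE (E0 xhat0) subee// add0e subee// mule0 -(@integral0 _ _ _ P setT).
  apply: le_integral_nomeas => w.
  by rewrite (E0 (xhat k w)) subee// add0e minE; exact: sub_le0.
have mu_eta k : mu * eta k.+1 <= 1.
  have [_ _ eta0 _ _] := hpar.
  have muL := strongly_convex_smooth_le hL hfL hfmu p0.
  apply: (@le_trans _ _ (L * eta k.+1)); first by rewrite ler_wpM2r// ltW.
  by rewrite mulrC -ler_pdivlMr.
have [alpha [u [phi run]]] : exists alpha u phi,
    descent_run f psi mu xstar eta gamma delta g x D0 D alpha u phi.
  case: hrun => [hA|hB].
    exact: (run_A_descent hL hfL hpsi_proper hpsi_convex hpsi_lsc hxstar hpar).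
  exact: (run_B_descent hL hfL hpsi_proper hpsi_convex hpsi_lsc hxstar hpar).
split=> [k k1|xhat0 xhat hx k _].
  exact: (last_iterate_bound hL hfL hfmu hpsi_proper hxstar hpar heta hFil hg mu_eta run).
exact: (averaged_iterate_bound hL hfL hmu hfmu hpsi_proper hpsi_convex hxstar hpar heta
  hFil hg mu_eta run).
Qed.
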